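(* Let $n\ge 0$ with $n+1\le 6$. The closed cone $\mathcal C^{n+1}_{\mathcal E}$ of flag vectors of Eulerian posets of rank $n+1$ is finitely generated. It has exactly $\binom{n}{\lfloor n/2\rfloor}$ extreme rays, all generated by the flag vectors of the doubled limit posets $DP(n,\mathcal I)$ for $\mathcal I$ even interval systems on $[1,n]$. It has exactly $\binom{n}{\lfloor n/2\rfloor}$ facets, each of which is determined either by the inequality $\sum_{Q\subseteq[1,n]}L_Q(P)\ge0$ or by an inequality $$(-1)^{|M|/2}\sum_{M\subseteq Q\subseteq V}L_Q(P)\ge0$$ for an admissible pair $(M,V)$.
   Context: $[a,b]=\{a,\dots,b\}$ for integers $a\le b$. For a finite set $S$ of integers, $\mathcal I[S]$ is the collection of maximal intervals (of consecutive integers) contained in $S$. A graded poset is a finite partially ordered set $P$ with a unique minimum $\hat 0$, a unique maximum $\hat 1$, and a rank function $\rho:P\to\mathbf{N}$ with $\rho(\hat 0)=0$ and $\rho(y)-\rho(x)=1$ whenever $y$ covers $x$; its rank is $\rho(\hat 1)$. For $P$ of rank $n+1$ and $S\subseteq[1,n]$, $f_S(P)$ is the number of chains $x_1<\cdots<x_{|S|}$ in $P$ with $\{\rho(x_1),\dots,\rho(x_{|S|})\}=S$; the flag vector is $(f_S(P):S\subseteq[1,n])\in\mathbf{R}^{2^n}$. $P$ is Eulerian if $\mu([x,y])=(-1)^{\rho(y)-\rho(x)}$ for every interval $[x,y]$ of $P$. The flag $L$-vector of $P$ is $L_S(P)=(-1)^{n-|S|}\sum_{T\supseteq[1,n]\setminus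 S}(-\tfrac12)^{|T|}f_T(P)$, $S\subseteq[1,n]$ (linear forms in the flag vector). $\mathcal{C}^{n+1}_{\mathcal E}$ is the closure of the convex cone generated by the flag vectors of all Eulerian posets of rank $n+1$. An inequality determines a facet if it is valid on the cone and equality defines a face of dimension one less than that of the cone. Admissible pairs: $(M,V)$ with $M\subseteq V\subseteq[1,n]$ is admissible if every $I\in\mathcal I[V]$ has cardinality at least $2$, every $I\in\mathcal I[[0,n+1]\setminus V]$ has cardinality at most $3$, and every $[a,b]\in\mathcal I[V]$ satisfies: (i) $M\cap[a,b]=\emptyset$, $[a,a+1]$, or $[b-1,b]$; (ii) if $a\notin M$ then $a-2\in\{-1\}\cup M$; (iii) if $b\notin M$ then $b+2\in\{n+2\}\cup M$. Limit posets: For an interval $I\subseteq[1,n]$ and a positive integer $N$, $D_I^N(P)$ is obtained from $P$ by replacing every $x\in P$ with $\rho(x)\in I$ by $N$ elements $x_1,\dots,x_N$, with: (i) if $\rho(x)\in I$, $\rho(y)\notin I$, then $x_i<y$ iff $x<y$ in $P$, and $y<x_i$ iff $y<x$ in $P$; (ii) if $\rho(x),\rho(y)\in I$, then $x_i<y_j$ iff $i=j$ and $x<y$ in $P$; other relations unchanged. An interval system on $[1,n]$ is a set of (nonempty) subintervals of $[1,n]$, none contained in another; it is even if $|I\cap J|$ is even for all $I,J\in\mathcal I$ (including $I=J$). $P(n,\mathcal I,N)$ is obtained from a chain of rank $n+1$ by applying $D_I^N$ for all $I\in\mathcal I$ (order irrelevant). The flag vector of the limit poset $P(n,\mathcal I)$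 is $f_S(P(n,\mathcal I))=\lim_{N\to\infty}f_S(P(n,\mathcal I,N))/N^{|\mathcal I|}$, and the flag vector of the doubled limit poset is $f_S(DP(n,\mathcal I))=2^{|S|}f_S(P(n,\mathcal I))$. *)

(* Defs.v *)
From HB Require Import structures.
From mathcomp Require Import all_boot all_order all_algebra.
From mathcomp Require Import all_classical all_reals all_analysis.

Set Implicit Arguments.
Unset Strict Implicit.
Unset Printing Implicit Defensive.

Import Order.TTheory GRing.Theory Num.Theory.
Import numFieldNormedType.Exports.

Local Open Scope classical_set_scope.
Local Open Scope ring_scope.

(* A subset S of [1, n] is encoded as S : {set 'I_n}, where i : 'I_n stands   *)
(* for the integer i.+1.                                                      *)
Definition ranks (n : nat) (S : {set 'I_n}) : seq nat :=
  [seq (nat_of_ord i).+1 | i <- enum S].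

Section Posets.
Local Open Scope order_scope.

Definition covers (d : Order.disp_t) (P : finPOrderType d) (x y : P) : bool :=
  (x < y) && [forall z : P, ~~ (x < z < y)].

Definition rank_function (d : Order.disp_t) (P : finTBPOrderType d)
    (rho : P -> nat) : Prop :=
  rho \bot = 0%N /\ forall x y : P, covers x y -> rho y = (rho x).+1.

(* The first argument bounds the depth of the recursion.                      *)
Fixpoint mobius_rec (d : Order.disp_t) (P : finPOrderType d) (k : nat)
    (x y : P) : int :=
  if x == y then 1%R
  else if k is k'.+1 then (- \sum_(z : P | (x <= z < y)%O) mobius_rec k' x z)%R
  else 0%R.

Definition mobius (d : Order.disp_t) (P : finPOrderType d) (x y : P) : int :=
  mobius_rec #|P| x y.

Lemma mobius_recS (d : Order.disp_t) (P : finPOrderType d) (k : nat) (x y : P) :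
  (#|[pred z : P | (x <= z < y)%O]| <= k)%N ->
  mobius_rec k x y = mobius_rec k.+1 x y.
Proof.
elim: k y => [|k IHk] y /=.
  rewrite leqn0 => /pred0P E; case: eqP => // _.
  by rewrite big_pred0 ?oppr0.
move=> hy; case: eqP => // /eqP nxy; congr (- _)%R.
apply: eq_bigr => z /andP[xz zy]; apply: IHk.
rewrite -ltnS; apply: leq_trans hy; apply: proper_card; apply/fintype.properP; split.
  by apply/fintype.subsetP=> t; rewrite !inE => /andP[-> /lt_trans ->].
by exists z; rewrite !inE ?xz ?zy ?ltxx.
Qed.

Lemma mobiusE (d : Order.disp_t) (P : finPOrderType d) (x y : P) :
  mobius x y = if x == y then 1%R
    else (- \sum_(z : P | (x <= z < y)%O) mobius x z)%R.
Proof. by rewrite /mobius (@mobius_recS _ _ #|P|) // max_card. Qed.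

Definition eulerian (d : Order.disp_t) (P : finTBPOrderType d)
    (rho : P -> nat) : Prop :=
  forall x y : P, x <= y -> mobius x y = ((-1) ^+ (rho y - rho x)%N)%R.

Definition flag_number (n : nat) (d : Order.disp_t) (P : finPOrderType d)
    (rho : P -> nat) (S : {set 'I_n}) : nat :=
  #|[pred c : #|S|.-tuple P | sorted <%O c & perm_eq (map rho c) (ranks S)]|.

(* Finite posets labelled by a strictly increasing rank; this is all that the *)
(* operation D_I^N needs.                                                     *)
Record ranked_poset := RankedPoset {
  rp_disp : Order.disp_t;
  rp_carrier :> finPOrderType rp_disp;
  rk : rp_carrier -> nat;
  rk_homo : forall x y : rp_carrier, x < y -> (rk x < rk y)%N }.

Lemma rk_le (P : ranked_poset) (x y : P) : x <= y -> (rk x <= rk y)%N.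
Proof. by rewrite le_eqVlt => /predU1P[->//|/rk_homo/ltnW]. Qed.

(* The carrier of D_[a,b]^N(P): N copies of x if a <= rk x <= b, else one.    *)
Definition dup (P : ranked_poset) (a b N : nat) : Type :=
  {x : P & 'I_(if a <= rk x <= b then N else 1)%N}.

HB.instance Definition _ (P : ranked_poset) (a b N : nat) :=
  Finite.on (dup P a b N).

Definition dup_le (P : ranked_poset) (a b N : nat) : rel (dup P a b N) :=
  fun u v => (tag u <= tag v) &&
    ((a <= rk (tag u) <= b)%N && (a <= rk (tag v) <= b)%N ==>
       (tagged u == tagged v :> nat)).

Lemma dup_le_refl (P : ranked_poset) (a b N : nat) :
  reflexive (@dup_le P a b N).
Proof. by move=> u; rewrite /dup_le lexx eqxx implybT. Qed.

Lemma dup_le_anti (P : ranked_poset) (a b N : nat) :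
  antisymmetric (@dup_le P a b N).
Proof.
move=> [x i] [y j]; rewrite /dup_le /= => /andP[/andP[xy h] /andP[yx _]].
have E : x = y by apply/le_anti; rewrite xy yx.
case: y / E j h {xy yx} => j h; congr existT; apply/val_inj => /=.
have /orP[E|E] := orbN (a <= rk x <= b)%N.
  by move/implyP: h; rewrite andbb => /(_ E)/eqP.
have N1 : ((if (a <= rk x <= b)%N then N else 1) = 1)%N by rewrite (negbTE E).
by case: i j {h} => [i hi] [j hj] /=; move: hi hj; rewrite N1; case: i j => [|i] [].
Qed.

Lemma dup_le_trans (P : ranked_poset) (a b N : nat) :
  transitive (@dup_le P a b N).
Proof.
move=> v u w /andP[uv huv] /andP[vw hvw]; rewrite /dup_le (le_trans uv vw) /=.
apply/implyP => /andP[hu hw].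
have hv : (a <= rk (tag v) <= b)%N.
  case/andP: hu => au _; case/andP: hw => _ wb.
  by rewrite (leq_trans au (rk_le uv)) (leq_trans (rk_le vw) wb).
move/implyP: huv => /(_ (introT andP (conj hu hv)))/eqP ->.
exact: (implyP hvw (introT andP (conj hv hw))).
Qed.

HB.instance Definition _ (P : ranked_poset) (a b N : nat) :=
  Order.Le_isPOrder.Build (Order.Disp tt tt) (dup P a b N)
    (@dup_le_refl P a b N) (@dup_le_anti P a b N) (@dup_le_trans P a b N).

Definition dup_rk (P : ranked_poset) (a b N : nat) (u : dup P a b N) : nat :=
  rk (tag u).

Lemma dup_rk_homo (P : ranked_poset) (a b N : nat) (u v : dup P a b N) :
  u < v -> (dup_rk u < dup_rk v)%N.
Proof.
rewrite lt_neqAle => /andP[nuv uv]; apply: rk_homo.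
rewrite lt_neqAle; case/andP: (uv) => -> _; rewrite andbT.
apply: contra nuv => /eqP E; apply/eqP; apply: (@dup_le_anti P a b N).
rewrite [dup_le u v]uv /=; case/andP: uv => _ /implyP h.
have vu : tag v <= tag u by move: (lexx (tag v)); rewrite -[in X in _ <= X]E.
by rewrite /dup_le vu /=; apply/implyP; rewrite andbC eq_sym.
Qed.

(* D_[a,b]^N(P)                                                               *)
Definition dup_poset (a b N : nat) (P : ranked_poset) : ranked_poset :=
  RankedPoset (@dup_rk_homo P a b N).

(* The chain of rank n + 1.                                                   *)
Definition chain_poset (n : nat) : ranked_poset :=
  @RankedPoset _ 'I_n.+2 (@nat_of_ord n.+2) (fun x y h => h).

End Posets.

(* A pair p with p.1 <= p.2 encodes the nonempty interval [p.1 + 1, p.2 + 1]  *)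
(* of [1, n].                                                                 *)
Definition itv_set (n : nat) (p : 'I_n * 'I_n) : {set 'I_n} :=
  [set k : 'I_n | (p.1 <= k <= p.2)%N]%SET.

Definition interval_system (n : nat) (II : {set 'I_n * 'I_n}) : Prop :=
  (forall p, p \in II -> (p.1 <= p.2)%N) /\
  (forall p q, p \in II -> q \in II -> itv_set p \subset itv_set q -> p = q).

Definition even_interval_system (n : nat) (II : {set 'I_n * 'I_n}) : Prop :=
  interval_system II /\
  forall p q, p \in II -> q \in II -> ~~ odd #|itv_set p :&: itv_set q|.

(* P(n, II, N)                                                                *)
Definition pre_limit_poset (n : nat) (II : {set 'I_n * 'I_n}) (N : nat) :
    ranked_poset :=
  foldr (fun (p : 'I_n * 'I_n) P => dup_poset p.1.+1 p.2.+1 N P) (chain_poset n) (enum II).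

(* The space R^(2^n), with coordinates indexed by the subsets of [1, n].      *)
Notation flag_space R n := 'rV[R]_(#|{set 'I_n}|).

Definition mk_flag (R : realType) (n : nat) (f : {set 'I_n} -> R) :
    flag_space R n :=
  \row_j f (enum_val j).

Definition flag_coord (R : realType) (n : nat) (v : flag_space R n)
    (S : {set 'I_n}) : R :=
  v ord0 (enum_rank S).

Definition flag_vector (R : realType) (n : nat) (d : Order.disp_t)
    (P : finPOrderType d) (rho : P -> nat) : flag_space R n :=
  mk_flag (fun S : {set 'I_n} => (flag_number rho S)%:R).

Definition limit_flag (R : realType) (n : nat) (II : {set 'I_n * 'I_n})
    (S : {set 'I_n}) : R :=
  lim ((fun N : nat =>
    (flag_number (@rk (pre_limit_poset II N)) S)%:R / N%:R ^+ #|II| : R) @ \oo).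

(* The flag vector of DP(n, II).                                              *)
Definition doubled_limit_flag_vector (R : realType) (n : nat)
    (II : {set 'I_n * 'I_n}) : flag_space R n :=
  mk_flag (fun S => 2 ^+ #|S| * limit_flag R II S).

Definition flagL (R : realType) (n : nat) (S : {set 'I_n})
    (v : flag_space R n) : R :=
  (-1) ^+ (n - #|S|)%N *
  \sum_(T : {set 'I_n} | ~: S \subset T) (- 2^-1) ^+ #|T| * flag_coord v T.

(* [a, b] is a maximal interval contained in A.                               *)
Definition max_interval (A : pred nat) (a b : nat) : Prop :=
  [/\ (a <= b)%N, (forall k, (a <= k <= b)%N -> A k) &
    forall c d, (c <= a)%N -> (b <= d)%N ->
      (forall k, (c <= k <= d)%N -> A k) -> c = a /\ d = b].

Definition admissible (n : nat) (M V : {set 'I_n}) : Prop :=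
  [/\ M \subset V,
      (forall a b, max_interval (mem (ranks V)) a b -> (2 <= b.+1 - a)%N),
      (forall a b,
        max_interval [pred k | (k <= n.+1)%N && (k \notin ranks V)] a b ->
        (b.+1 - a <= 3)%N) &
      forall a b, max_interval (mem (ranks V)) a b ->
        [/\ let Mab := [pred k | (k \in ranks M) && (a <= k <= b)%N] in
            [\/ Mab =i pred0, Mab =i [pred k | (a <= k <= a.+1)%N]
              | Mab =i [pred k | (b.-1 <= k <= b)%N] ],
            a \notin ranks M -> a = 1%N \/ (exists2 m, m \in ranks M & a = (m + 2)%N) &
            b \notin ranks M -> (b + 2 = n + 2)%N \/ (b + 2)%N \in ranks M]].

Section Cones.
Variables (R : realType) (m : nat).
Local Notation E := 'rV[R]_m.

Definition conic_hull (A : set E) : set E :=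
  [set v | exists (k : nat) (c : 'I_k -> R) (x : 'I_k -> E),
    [/\ forall i, 0 <= c i, forall i, A (x i) & v = \sum_i c i *: x i]].

Definition finitely_generated (C : set E) : Prop :=
  exists s : seq E, C = conic_hull [set` s].

Definition ray (v : E) : set E := [set x | exists2 t : R, 0 <= t & x = t *: v].

Definition extreme_ray (C r : set E) : Prop :=
  exists v : E, [/\ v != 0, C v, r = ray v &
    forall x y, C x -> C y -> r (x + y) -> r x /\ r y].

(* For sets containing the origin, in particular for closed cones and their   *)
(* faces, the affine hull is the linear span.                                 *)
Definition cone_dim (A : set E) (k : nat) : Prop :=
  exists U : {vspace E},
    [/\ forall x, A x -> x \in U,
        (forall W : {vspace E}, (forall x, A x -> x \in W) -> (U <= W)%VS) &
        \dim U = k].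

(* The inequality 0 <= l is valid on C and determines the facet F.            *)
Definition determines_facet (C : set E) (l : E -> R) (F : set E) : Prop :=
  [/\ forall x, C x -> 0 <= l x,
      F = C `&` [set x | l x = 0] &
      exists k, cone_dim C k.+1 /\ cone_dim F k].

Definition facet (C F : set E) : Prop :=
  exists l : {scalar E}, determines_facet C l F.

End Cones.

Definition eulerian_flag_vectors (R : realType) (n : nat) :
    set (flag_space R n) :=
  [set v | exists (d : Order.disp_t) (P : finTBPOrderType d) (rho : P -> nat),
    [/\ rank_function rho, rho (Order.top : P) = n.+1, eulerian rho &
        v = flag_vector R n rho]].

Definition eulerian_cone (R : realType) (n : nat) : set (flag_space R n) :=
  closure (conic_hull (@eulerian_flag_vectors R n)).

(* Main.v *)
(* Up to the factor 2^-|A|, A = [1, n] \ V, the form of an admissible pair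
   (M, V) is a sum over the chains with rank set A of products over the gaps
   of the chain.  In an Eulerian poset a gap meeting M contributes 1 - a/2,
   where a is its number of atoms or of coatoms, hence a nonpositive factor.
   Cutting chains in the same way, L_S vanishes unless all maximal intervals of
   S are even: the sum of (-1/2)^|c| over the chains c of an open Eulerian
   interval of even rank is zero.  Conversely DP(n, I, N) is Eulerian when I is
   even, so that the DP(n, I) lie in the closed cone.
   In rank at most 6 each form takes the value 1 on one or two of the rays
   DP(n, I) and 0 on the others; the cone is a product of rays and of cones
   over squares, which gives the conic decomposition of every point satisfying
   the inequalities, and the incidence table yields extreme rays and facets. *)
From HB Require Import structures.
Require Import Defs.
From mathcomp Require Import all_boot all_order all_algebra.
From mathcomp Require Import all_classical all_reals all_analysis.
From mathcomp Require Import ring lra zify.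
Import Order.TTheory GRing.Theory Num.Theory.
Import numFieldNormedType.Exports.
Local Open Scope ring_scope.
Set Implicit Arguments.
Unset Strict Implicit.
Unset Printing Implicit Defensive.

(** * Subsets as bit strings *)

(** The closed cone is identified by a circle of inclusions. The equations $L_S=0$ (for $S$ with an
    odd run) and the inequalities pass from Eulerian flag vectors to the closure; every point
    satisfying them is an explicit nonnegative combination of the rays; and the rays are limits of
    scaled flag vectors of Eulerian posets. The sum over $M\subseteq Q\subseteq V$ has exponentially
    many terms, but a chain sum is linear in the letter attached to each rank, so the whole form is
    a single word. At a rank of $V\setminus M$ the two choices combine to the letter that ignores
    the rank; this is what leaves a product over gaps. Finite sets over ['I_n] are unsuitable for
    evaluation. Subsets therefore become bit strings, interval systems become lists of pairs, and
    the values of forms on rays become integers. The facts that depend on the tables for $n\le5$ are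
    gathered in the boolean [data_ok], evaluated for the six values of $n$. This includes the
    Eulerian property of the doubled posets, through the criterion [balanced], which does not
    involve $N$. *)

Definition bool_between (a b : bool) : seq bool :=
  if a then [:: true] else if b then [:: false; true] else [:: false].

Fixpoint bits_between (m v : bitseq) : seq bitseq :=
  match m, v with
  | a :: m', b :: v' =>
      [seq o :: t | o <- bool_between a b, t <- bits_between m' v']
  | _, _ => [:: [::]]
  end.

Definition all_bits n := bits_between (nseq n false) (nseq n true).

Definition set_of_bits n (b : bitseq) : {set 'I_n} :=
  [set i : 'I_n | nth false b i]%SET.

Definition bits_of_set n (S : {set 'I_n}) : bitseq := [seq i \in S | i <- enum 'I_n].

Lemma size_bits_of_set n (S : {set 'I_n}) : size (bits_of_set S) = n.
Proof. by rewrite size_map size_enum_ord. Qed.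

Lemma nth_bits_of_set n (S : {set 'I_n}) (i : 'I_n) :
  nth false (bits_of_set S) i = (i \in S).
Proof. by rewrite (nth_map i) ?size_enum_ord // nth_ord_enum. Qed.

Lemma bits_of_setK n : cancel (@bits_of_set n) (@set_of_bits n).
Proof. by move=> S; apply/setP=> i; rewrite inE nth_bits_of_set. Qed.

Lemma set_of_bitsK n (b : bitseq) : size b = n -> bits_of_set (set_of_bits n b) = b.
Proof.
move=> sb; apply: (@eq_from_nth _ false) => [|i]; rewrite size_bits_of_set ?sb //.
by move=> ltin; rewrite (nth_bits_of_set _ (Ordinal ltin)) inE.
Qed.

Lemma mem_bits_between m v b : size m = size v -> all2 implb m v ->
  (b \in bits_between m v) = [&& size b == size m, all2 implb m b & all2 implb b v].
Proof.
elim: m v b => [|a m IH] [|c v] //= b; first by case: b.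
move=> [sz] /andP[ac mv]; case: b => [|o b].
  by apply/negbTE/negP => /allpairsP[[? ?] [_ _]].
apply/allpairsP/idP => [[[x t] /= [io it [-> ->]]]|].
  move: it; rewrite IH // => /and3P[st mt tv].
  rewrite eqSS st mt tv !andbT /=.
  by case: a c ac io => [] [] //= _; rewrite !inE; case: x.
rewrite eqSS => /and3P[sb /andP[ao mb] /andP[oc bv]].
exists (o, b); split => //=; last by rewrite IH ?sb ?mb.
by case: a c o ac ao oc => [] [] [].
Qed.

Lemma uniq_bits_between m v : uniq (bits_between m v).
Proof.
elim: m v => [|a m IH] [|c v] //=; apply: allpairs_uniq => //.
  by case: a c => [] [].
by move=> [? ?] [? ?] _ _ /= [-> ->].
Qed.

Lemma subset_bits n (b c : bitseq) : size b = n -> size c = n ->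
  (set_of_bits n b \subset set_of_bits n c) = all2 implb b c.
Proof.
move=> sb sc; have E : all2 implb b c = all (fun i => nth false b i ==> nth false c i) (iota 0 n).
  elim: n b c sb sc => [|n IH] [|x b] [|y c] //= [sb] [sc].
  by rewrite IH // -add1n iotaDl all_map.
rewrite E; apply/fintype.subsetP/allP => [H i|H i].
  rewrite mem_iota /= add0n => lt; have := H (Ordinal lt); rewrite !inE /= => H'.
  by apply/implyP.
rewrite !inE => bi; have := H (nat_of_ord i); rewrite mem_iota /= ltn_ord => /(_ isT).
by move/implyP; apply.
Qed.

Lemma size_mem_bits_between m v b : size m = size v -> all2 implb m v ->
  b \in bits_between m v -> size b = size m.
Proof. by move=> sz mv; rewrite mem_bits_between // => /and3P[/eqP]. Qed.

(** Bridge from sums over finite sets to sums over an explicit list, which can be evaluated and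
    treated by induction on the strings. *)
Lemma sum_set_bits (R : nmodType) n (m v : bitseq) (F : {set 'I_n} -> R) :
  size m = n -> size v = n -> all2 implb m v ->
  \sum_(Q : {set 'I_n} | (set_of_bits n m \subset Q) && (Q \subset set_of_bits n v)) F Q
  = \sum_(b <- bits_between m v) F (set_of_bits n b).
Proof.
move=> sm sv mv; rewrite -big_enum_cond -(big_map (@set_of_bits n) xpredT F) -big_filter.
apply: perm_big; apply: uniq_perm.
- by rewrite filter_uniq // enum_uniq.
- rewrite map_inj_in_uniq ?uniq_bits_between // => b c.
  move=> /size_mem_bits_between sb /size_mem_bits_between sc /(congr1 (@bits_of_set n)).
  by rewrite !set_of_bitsK // ?sb ?sc ?sm ?sv.
move=> Q; rewrite mem_filter mem_enum andbC.
rewrite -[_ && _]/((set_of_bits n m \subset Q) && (Q \subset set_of_bits n v)).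
apply/idP/mapP => [H|[b hb ->]].
  exists (bits_of_set Q); last by rewrite bits_of_setK.
  rewrite mem_bits_between ?size_bits_of_set ?sm ?sv ?eqxx //=.
  by rewrite -!(@subset_bits n) ?size_bits_of_set // bits_of_setK.
move: hb; rewrite mem_bits_between ?sm ?sv // => /and3P[/eqP sb mb bv].
by rewrite !subset_bits // mb.
Qed.

Lemma set_of_nseq_true n : set_of_bits n (nseq n true) = finset.setT.
Proof. by apply/setP=> i; rewrite !inE nth_nseq ltn_ord. Qed.

Lemma implb_nseq_false n b : size b = n -> all2 implb (nseq n false) b.
Proof. by elim: n b => [|n IH] [|x b] //= [/IH]. Qed.

Lemma implb_nseq_true n b : size b = n -> all2 implb b (nseq n true).
Proof. by elim: n b => [|n IH] [|[] b] //= [/IH]. Qed.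

Lemma setC_bits n b : size b = n -> (~: set_of_bits n b)%SET = set_of_bits n (map negb b).
Proof.
by move=> sb; apply/setP=> i; rewrite !inE (nth_map false) // sb.
Qed.

Lemma card_set_of_bits n b : size b = n -> #|set_of_bits n b| = count id b.
Proof.
move=> sb; rewrite cardsE cardE size_filter; rewrite -[in RHS](set_of_bitsK sb) count_map.
by rewrite enumT; apply: eq_count => i /=; rewrite inE.
Qed.

(** * Chain sums *)

Section ChainSums.
Variables (R : comNzRingType) (d : Order.disp_t) (P : finPOrderType d).
Variable rho : P -> nat.
Implicit Types (x y z : P) (r : nat) (w : seq (R * R)).

(* A sum over the chains of the open interval (x, y): the letters (p, q) of w
   belong to the ranks r, r + 1, ..., and contribute p if the chain avoids that
   rank, q otherwise. *)
Fixpoint chain_sum x y r w : R :=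
  if w is c :: w' then
    c.1 * chain_sum x y r.+1 w' +
    c.2 * \sum_(z | (x < z < y)%O && (rho z == r)) chain_sum z y r.+1 w'
  else 1.

(** The letter $(0,q)$ kills the chains that avoid its rank; every other chain has an element $z$
    there, which cuts it into a chain of $(x,z)$ and one of $(z,y)$. *)
Lemma chain_sum_cat x y r w1 q w2 :
  chain_sum x y r (w1 ++ (0, q) :: w2) =
  q * \sum_(z | (x < z < y)%O && (rho z == (r + size w1)%N))
        chain_sum x z r w1 * chain_sum z y (r + size w1).+1 w2.
Proof.
elim: w1 x r => [|c w1 IH] x r /=.
  by rewrite mul0r add0r addn0; congr (_ * _); apply: eq_bigr => z _; rewrite mul1r.
rewrite IH; under eq_bigr do rewrite IH.
rewrite -big_distrr /= mulrCA [c.2 * _]mulrCA -mulrDr; congr (_ * _).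
rewrite addSnnS !big_distrr /=.
under [RHS]eq_bigr do rewrite mulrDl -!mulrA.
rewrite big_split /=; congr (_ + _).
rewrite -!big_distrr /=; congr (_ * _).
under [RHS]eq_bigr do rewrite big_distrl /=.
(* The recursion picks the element $t$ of the first rank before the cut element $z$; after the
   exchange $z$ comes first and $t$ ranges over $(x,z)$. *)
rewrite (exchange_big_dep (fun z => (x < z < y)%O && (rho z == (r + (size w1).+1)%N))) /=.
  apply: eq_bigr => z /andP[/andP[xz zy] rz].
  apply: eq_bigl => t; rewrite rz zy !andbT.
  apply/idP/idP => [/andP[/andP[/andP[-> _] ->] ->]//|/andP[/andP[xt tz] ->]].
  by rewrite xt tz (lt_trans tz zy).
by move=> t z /andP[/andP[xt ty] rt] /andP[/andP[tz ->] ->]; rewrite (lt_trans xt tz).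
Qed.

Definition letter_sum (f : bool -> R * R) (g : bool -> R) (a b : bool) : R * R :=
  (\sum_(o <- bool_between a b) g o * (f o).1,
   \sum_(o <- bool_between a b) g o * (f o).2).

Fixpoint word_between f g (m v : bitseq) : seq (R * R) :=
  match m, v with
  | a :: m', b :: v' => letter_sum f g a b :: word_between f g m' v'
  | _, _ => [::]
  end.

(** Distributivity, rank by rank: the letters of the resulting word are the weighted sums of the
    letters allowed at each rank. *)
Lemma sum_bits_between f g m v x y r : size m = size v ->
  \sum_(b <- bits_between m v) (\prod_(o <- b) g o) * chain_sum x y r (map f b)
  = chain_sum x y r (word_between f g m v).
Proof.
elim: m v x r => [|a m IH] [|c v] //= x r; first by rewrite big_seq1 big_nil mul1r.
move=> [sz]; rewrite big_allpairs_dep /= !big_distrl -big_split /=.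
apply: eq_bigr => o _; under eq_bigr do rewrite big_cons mulrDr.
rewrite big_split /=; congr (_ + _).
  rewrite -IH // big_distrr /=; apply: eq_bigr => t _; ring.
under [X in _ = _ * X]eq_bigr do rewrite -IH //.
rewrite exchange_big big_distrr /=; apply: eq_bigr => t _.
rewrite -!big_distrr /=; ring.
Qed.

End ChainSums.

(** * Chain sums with forced and forbidden ranks count chains *)

Section Chains.
Variables (R : comNzRingType) (d : Order.disp_t) (P : finPOrderType d).
Variable rho : P -> nat.
Hypothesis rho_homo : forall x y : P, (x < y)%O -> (rho x < rho y)%N.

Definition bit_letter (o : bool) : R * R := ((~~ o)%:R, o%:R).

Fixpoint positions r (b : bitseq) : seq nat :=
  if b is o :: b' then (if o then [:: r] else [::]) ++ positions r.+1 b' else [::].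

Fixpoint chains (x y : P) (s : seq nat) : seq (seq P) :=
  if s is r :: s' then
    flatten [seq [seq z :: c | c <- chains z y s'] |
             z <- enum P & (x < z < y)%O && (rho z == r)]
  else [:: [::]].

Lemma chain_sum_bits x y r b :
  chain_sum rho x y r (map bit_letter b) = (size (chains x y (positions r b)))%:R.
Proof.
elim: b x r => [|o b IH] x r //=; case: o => /=; last by rewrite mul1r mul0r addr0 IH.
rewrite mul0r add0r mul1r size_flatten sumnE big_map big_map big_filter big_enum_cond /=.
by rewrite natr_sum; apply: eq_bigr => z _; rewrite IH size_map.
Qed.

Lemma mem_chains x y s c :
  (c \in chains x y s) = [&& path <%O x c, all (fun z => z < y)%O c & map rho c == s].
Proof.
elim: s x c => [|r s IH] x c /=.
  by case: c => [|z c] //=; rewrite !andbF.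
apply/flatten_mapP/and3P => [[z]|].
  rewrite mem_filter => /andP[/andP[/andP[xz zy] /eqP rz] _] /mapP[c'].
  by rewrite IH => /and3P[pc ac /eqP <-] ->; rewrite /= xz pc zy ac rz eqxx.
case: c => [|z c] [] //= /andP[xz pc] /andP[zy ac] /eqP[rz mc].
exists z; first by rewrite mem_filter xz zy rz eqxx mem_enum.
by apply/mapP; exists c => //; rewrite IH pc ac mc eqxx.
Qed.

Lemma uniq_chains x y s : uniq (chains x y s).
Proof.
elim: s x => [|r s IH] x //=.
elim: [seq z <- enum P | _] (filter_uniq (fun z => (x < z < y)%O && (rho z == r)) (enum_uniq P)) => //= z l IHl /andP[nzl ul].
rewrite cat_uniq IHl // andbT map_inj_uniq ?IH /=; last by move=> ? ? [].
apply/hasPn => c /flatten_mapP[t tl /mapP[c' _ ->]]; apply/negP => /mapP[? _ [E _]].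
by rewrite -E tl in nzl.
Qed.

Lemma card_chains k x y s : size s = k ->
  #|[pred c : k.-tuple P | [&& path <%O x c, all (fun z => z < y)%O c & map rho c == s]]|
  = size (chains x y s).
Proof.
move=> sk; rewrite cardE -(size_map val); apply: perm_size; apply: uniq_perm.
- by rewrite map_inj_uniq ?enum_uniq //; exact: val_inj.
- exact: uniq_chains.
move=> c; rewrite mem_chains; apply/mapP/idP => [[t]|H].
  by rewrite mem_enum => ? ->.
have sc : size c == k by case/and3P: H => _ _ /eqP mc; rewrite -sk -mc size_map.
by exists (Tuple sc); rewrite ?mem_enum.
Qed.

Lemma positions_nat r b :
  positions r b = [seq i <- iota r (size b) | nth false b (i - r)].
Proof.
elim: b r => [|o b IH] r //=; rewrite subnn /=.
have -> : [seq i <- iota r.+1 (size b) | nth false (o :: b) (i - r)] = positions r.+1 b.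
  rewrite IH; apply: eq_in_filter => i; rewrite mem_iota => /andP[lt _].
  by rewrite -[(i - r)%N]/(i - r)%N subnS -[in LHS](@prednK (i - r)%N) ?subn_gt0.
by case: o.
Qed.

Lemma ranks_positions n (S : {set 'I_n}) : ranks S = positions 1 (bits_of_set S).
Proof.
rewrite positions_nat size_bits_of_set /ranks.
rewrite -[iota 1 n]/(iota (1 + 0) n) iotaDl -val_enum_ord -map_comp filter_map.
have -> : enum S = [seq i <- enum 'I_n | i \in S] 
  by rewrite /enum_mem -filter_predI; apply: eq_filter => i; rewrite /= andbT.
congr map; apply: eq_filter => i /=.
by rewrite subn1 nth_bits_of_set.
Qed.

(** Ranks coming from $S$ lie in $[1,n]$, so a chain with these ranks automatically stays strictly
    between the minimum and the maximum; both sides count the same chains. *)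
Lemma flag_number_chain_sum n (S : {set 'I_n}) (x y : P) :
  (forall z, x <= z)%O -> (forall z, z <= y)%O -> rho x = 0%N -> rho y = n.+1 ->
  (flag_number rho S)%:R = chain_sum rho x y 1 (map bit_letter (bits_of_set S)).
Proof.
move=> xmin ymax rx ry; rewrite chain_sum_bits -ranks_positions; congr (_%:R).
rewrite -(@card_chains #|S|); last by rewrite size_map -cardE.
apply: eq_card => c; rewrite !inE.
have sS : sorted ltn (ranks S).
  rewrite ranks_positions positions_nat; apply: sorted_filter; first exact: ltn_trans.
  exact: iota_ltn_sorted.
have rng k : k \in ranks S -> (0 < k < n.+1)%N.
  by move=> /mapP[i _ ->]; rewrite /= ltnS.
apply/andP/and3P => [[sc pc]|[pc ac /eqP mc]].
  (* Both rank lists are strictly increasing, so equality up to permutation is equality. *)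
  have mc : map rho c = ranks S.
    apply: (@irr_sorted_eq _ ltn ltn_trans ltnn _ _ _ sS) => [|k]; last exact: perm_mem.
    by apply: homo_sorted sc => a b; exact: rho_homo.
  have rc z : z \in val c -> (0 < rho z < n.+1)%N by move=> zc; apply: rng; rewrite -mc map_f.
  split; last by rewrite mc.
    case: c sc rc {pc mc} => c sc2 /= sc rc; case: c sc rc {sc2} => //= z t pz rc; rewrite pz andbT lt_neqAle xmin andbT.
    by apply/eqP => E; move: (rc z (mem_head _ _)); rewrite -E rx.
  - apply/allP => z /rc /andP[_ lt]; rewrite lt_neqAle ymax andbT.
    by apply/eqP => E; move: lt; rewrite E ry ltnn.
split; last by rewrite mc.
exact: path_sorted pc.
Qed.

End Chains.

(** * Eulerian intervals *)

Section RankFunction.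
Variables (d : Order.disp_t) (P : finTBPOrderType d) (rho : P -> nat).
Hypothesis rhoP : rank_function rho.

(** [rank_function] constrains covers only. A comparison that is not a cover is split at an
    intermediate element, and both new open intervals lose that element. *)
Lemma rank_function_homo (x y : P) : (x < y)%O -> (rho x < rho y)%N.
Proof.
have [k] := ubnP #|[pred z : P | (x < z < y)%O]|; elim: k x y => // k IH x y.
rewrite ltnS => le_k xy; have [cxy|] := boolP (covers x y); first by rewrite (rhoP.2 _ _ cxy).
rewrite /covers xy /= negb_forall => /existsP[z]; rewrite negbK => /andP[xz zy].
have lt_k (a b : P) : (x <= a)%O -> (b <= y)%O -> ~~ (a < z < b)%O ->
    (#|[pred t : P | (a < t < b)%O]| < k)%N.
  move=> xa by_ nz; apply: leq_trans le_k; apply: proper_card; apply/fintype.properP; split.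
    by apply/fintype.subsetP=> t; rewrite !inE => /andP[/(le_lt_trans xa) -> /lt_le_trans ->].
  by exists z; rewrite !inE ?xz ?zy.
apply: (@ltn_trans (rho z)); apply: IH => //; apply: lt_k; rewrite ?ltxx ?andbF ?lexx //; exact: ltW.
Qed.

Lemma exists_rank (x y : P) j : (x < y)%O -> (rho x < j < rho y)%N ->
  exists z, (x < z < y)%O && (rho z == j).
Proof.
have [k] := ubnP #|[pred z : P | (x < z < y)%O]|; elim: k x y => // k IH x y.
rewrite ltnS => le_k xy rj; have [cxy|] := boolP (covers x y).
  by move: rj; rewrite (rhoP.2 _ _ cxy) ltnS; case: ltnP.
rewrite /covers xy /= negb_forall => /existsP[z]; rewrite negbK => /andP[xz zy].
have lt_k (a b : P) : (x <= a)%O -> (b <= y)%O -> ~~ (a < z < b)%O ->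
    (#|[pred t : P | (a < t < b)%O]| < k)%N.
  move=> xa by_ nz; apply: leq_trans le_k; apply: proper_card; apply/fintype.properP; split.
    by apply/fintype.subsetP=> t; rewrite !inE => /andP[/(le_lt_trans xa) -> /lt_le_trans ->].
  by exists z; rewrite !inE ?xz ?zy.
case/andP: rj => xj jy; case: (ltngtP j (rho z)) => jz.
- have [||t /andP[/andP[xt tz] tj]] := IH x z _ xz; first by apply: lt_k; rewrite ?ltxx ?andbF //; exact: ltW.
    by rewrite xj.
  by exists t; rewrite xt tj (lt_trans tz zy).
- have [||t /andP[/andP[zt ty] tj]] := IH z y _ zy; first by apply: lt_k; rewrite ?ltxx //; exact: ltW.
    by rewrite jz.
  by exists t; rewrite ty tj (lt_trans xz zt).
by exists z; rewrite xz zy jz eqxx.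
Qed.

(** The recursion of $\mu$ says $\sum_{x\le z\le y}\mu(x,z)=0$, and the Eulerian value of $\mu(x,z)$
    differs from $(-1)^{\rho(z)}$ by the sign $(-1)^{\rho(x)}$, which does not depend on $z$. *)
Lemma eulerian_sum (R : pzRingType) (x y : P) : eulerian rho -> (x < y)%O ->
  \sum_(z | (x <= z <= y)%O) (-1) ^+ rho z = 0 :> R.
Proof.
move=> eP xy.
suff E : \sum_(z : P | (x <= z <= y)%O) (-1) ^+ (rho z - rho x) = 0 :> int.
  transitivity ((-1) ^+ rho x * (\sum_(z : P | (x <= z <= y)%O) (-1) ^+ (rho z - rho x))%:~R : R).
    rewrite rmorph_sum big_distrr; apply: eq_bigr => z /andP[xz _].
    rewrite /= rmorph_sign -exprD subnKC //.
    by move: xz; rewrite le_eqVlt => /predU1P[->//|/rank_function_homo/ltnW].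
  by rewrite E mulr0.
rewrite (bigD1 y) ?(ltW xy) ?lexx //= -(eP _ _ (ltW xy)) mobiusE (lt_eqF xy).
rewrite addrC; apply/eqP; rewrite subr_eq0; apply/eqP; apply: eq_big => [z|z /andP[/andP[xz _] _]].
  by rewrite -andbA [(z < y)%O]lt_neqAle [(z != y) && _]andbC.
by rewrite eP.
Qed.

End RankFunction.

Section EulerianIntervals.
Variables (R : realFieldType) (d : Order.disp_t) (P : finTBPOrderType d).
Variable rho : P -> nat.
Hypothesis rhoP : rank_function rho.
Hypothesis eP : eulerian rho.
Local Notation chain_sum := (@chain_sum R d P rho).
Local Notation s x := ((-1) ^+ rho x : R).

Let rho_lt := rank_function_homo rhoP.
Let euler_sum (x y : P) := @eulerian_sum d P rho rhoP R x y eP.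

(** A single atom $a$ would give $(x,y]=[a,y]$. The alternating sums over $[x,y]$ and $[a,y]$ both
    vanish, so the term of $x$ alone would be zero. *)
Lemma eulerian_atoms (x y : P) : (x < y)%O -> ((rho x).+1 < rho y)%N ->
  (2 <= #|[pred z : P | (x < z < y)%O && (rho z == (rho x).+1)]|)%N.
Proof.
move=> xy rxy; rewrite leqNgt ltnS; apply/negP => /fintype.card_le1_eqP H.
have [||a aP] := @exists_rank _ _ _ rhoP x y (rho x).+1 => //; first by rewrite ltnSn.
have /andP[/andP[xa ay] ra] := aP.
have above (z : P) : (x < z <= y)%O = (a <= z <= y)%O.
  apply/idP/idP => /andP[xz zy]; rewrite zy andbT; last exact: lt_le_trans xz.
  have := rho_lt xz; rewrite leq_eqVlt => /predU1P[E|lt].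
    have -> // : z = a.
    apply: H; rewrite // inE xz -E eqxx lt_neqAle zy !andbT.
    by apply: contraTneq rxy => <-; rewrite -E ltnn.
  have [|t /andP[/andP[xt tz] rt]] := @exists_rank _ _ _ rhoP x z (rho x).+1 xz; first by rewrite ltnSn.
  have -> : a = t by apply: H; rewrite // inE xt rt (lt_le_trans tz zy).
  exact: ltW.
have := euler_sum xy; rewrite (bigD1 x) ?lexx ?ltW //=.
rewrite (eq_bigl (fun z => a <= z <= y)%O) => [|z]; last first.
  by rewrite -above lt_neqAle [x == z]eq_sym andbC andbA.
rewrite euler_sum // addr0 => /eqP; rewrite expf_eq0 oppr_eq0 oner_eq0 andbF.
by [].
Qed.

Lemma eulerian_coatoms (x y : P) k : (x < y)%O -> rho y = k.+1 -> (rho x < k)%N ->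
  (2 <= #|[pred z : P | (x < z < y)%O && (rho z == k)]|)%N.
Proof.
move=> xy ry rxy; rewrite leqNgt ltnS; apply/negP => /fintype.card_le1_eqP H.
have [||a aP] := @exists_rank _ _ _ rhoP x y k => //; first by rewrite rxy ry /=.
have /andP[/andP[xa ay] ra] := aP.
have below (z : P) : (x <= z < y)%O = (x <= z <= a)%O.
  apply/idP/idP => /andP[xz zy]; rewrite xz /=; last exact: le_lt_trans ay.
  have := rho_lt zy; rewrite ry ltnS leq_eqVlt => /predU1P[E|lt].
    have -> // : z = a.
    apply: H; rewrite // inE zy E eqxx lt_neqAle xz !andbT.
    by apply: contraTneq rxy => ->; rewrite E ltnn.
  have [|t /andP[/andP[zt ty] rt]] := @exists_rank _ _ _ rhoP z y k zy; first by rewrite lt ry /=.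
  have -> : a = t by apply: H; rewrite // inE ty rt (le_lt_trans xz zt).
  exact: ltW.
have := euler_sum xy; rewrite (bigD1 y) ?lexx ?ltW //=.
rewrite (eq_bigl (fun z => x <= z <= a)%O) => [|z]; last first.
  by rewrite -below lt_neqAle -andbA [(z <= y)%O && _]andbC.
rewrite euler_sum // addr0 => /eqP; rewrite expf_eq0 oppr_eq0 oner_eq0 andbF.
by [].
Qed.

Lemma eulerian_thin (x y : P) : (x < y)%O -> rho y = (rho x).+2 ->
  #|[pred z : P | (x < z < y)%O && (rho z == (rho x).+1)]| = 2%N.
Proof.
move=> xy ry; suff: 2%:R = #|[pred z : P | (x < z < y)%O && (rho z == (rho x).+1)]|%:R :> R.
  by move/eqP; rewrite eqr_nat => /eqP.
have := euler_sum xy; rewrite (bigD1 x) ?lexx ?ltW //= (bigD1 y) ?lexx ?gt_eqF ?ltW //=.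
have E (z : P) : (x <= z <= y)%O && (z != x) && (z != y) = (x < z < y)%O && (rho z == (rho x).+1).
  apply/idP/idP => [/andP[/andP[/andP[xz zy] nx] ny]|/andP[/andP[xz zy] _]]; last first.
    by rewrite !ltW // gt_eqF // lt_eqF.
  have lxz : (x < z)%O by rewrite lt_neqAle eq_sym nx.
  have lzy : (z < y)%O by rewrite lt_neqAle ny.
  rewrite lxz lzy /= eqn_leq rho_lt // andbT -ltnS -ry; exact: rho_lt.
under eq_bigl do rewrite E; rewrite ry !exprS.
under eq_bigr => z /andP[_ /eqP ->] do rewrite exprS.
rewrite sumr_const !mulN1r opprK mulNrn => /eqP.
rewrite addrA -mulr2n subr_eq0 -!(mulr_natl (s x)) => /eqP/mulIf; apply.
by rewrite expf_eq0 oppr_eq0 oner_eq0 andbF.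
Qed.

Definition opt_letter : R * R := (1, - 2^-1).

(** Chains are sorted by their least element $z$: the empty chain gives 1, and what follows $z$ is
    again a word of optional letters, starting at rank $\rho(z)+1$. *)
Lemma chain_sum_opt_first (x y : P) r m : rho y = (r + m)%N ->
  chain_sum x y r (nseq m opt_letter) =
  1 - 2^-1 * \sum_(z | (x < z < y)%O && (r <= rho z)%N)
      chain_sum z y (rho z).+1 (nseq (rho y - (rho z).+1) opt_letter).
Proof.
elim: m x r => [|m IH] x r ry /=.
  rewrite big_pred0 ?mulr0 ?subr0 // => z; apply/negbTE/negP => /andP[/andP[_ /rho_lt]].
  by rewrite ry addn0 => /leq_trans/[apply]; rewrite ltnn.
rewrite IH ?addSnnS // mul1r -addrA; congr (1 + _).
rewrite mulNr -opprD -mulrDr; congr (- (_ * _)).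
rewrite [RHS](bigID (fun z => rho z == r)) /= [LHS]addrC; congr (_ + _).
  apply: eq_big => [z|z /andP[_ /eqP ->]]; last by rewrite ry addnS -addSn addKn.
  by case: (rho z =P r) => [->|]; rewrite ?leqnn ?andbT ?andbF.
by apply: eq_bigl => z; case: (x < z < y)%O => //=; case: ltngtP.
Qed.

Let open_left (x y z : P) : (x <= z < y)%O && (z != x) = (x < z < y)%O.
Proof. by rewrite [(x < z)%O]lt_neqAle [x == z]eq_sym; case: (z == x); rewrite ?andbF ?andbT. Qed.

(* In the incidence algebra this is K = (zeta - 1)(zeta + 1)^-1, and the
   Eulerian condition says that conjugation by the sign (-1)^rho inverts zeta,
   hence changes K into -K. *)
Lemma eulerian_chain_sum0 (x y : P) m : (x < y)%O -> rho y = ((rho x).+1 + m)%N ->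
  odd m -> chain_sum x y (rho x).+1 (nseq m opt_letter) = 0.
Proof.
pose K (u : P) := chain_sum u y (rho u).+1 (nseq (rho y - (rho u).+1) opt_letter).
have K1 u : (u < y)%O -> K u *+ 2 + \sum_(z | (u < z < y)%O) K z = 2.
  move=> uy; rewrite {1}/K chain_sum_opt_first ?subnKC ?rho_lt //.
  rewrite (eq_bigl (fun z => (u < z < y)%O)) => [|z].
    by rewrite -/(K _) mulr2n -/(K _); set S := \sum_(_ | _) _; field.
  by apply: andb_idr => /andP[/rho_lt].
(* The same recursion as [K1], for the sign-twisted negative of $K$. It comes from [K1] weighted by
   the sign of $z$ and summed over $u\le z<y$. *)
have K2 u : (u < y)%O ->
    - (s u * s y * K u) *+ 2 + \sum_(z | (u < z < y)%O) - (s z * s y * K z) = 2.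
  move=> uy.
  have D z : (u <= z < y)%O ->
      s z * K z + s z * \sum_(t | (z <= t < y)%O) K t = s z * 2.
    move=> /andP[uz zy]; rewrite -mulrDr -(K1 z zy); congr (_ * _).
    rewrite mulr2n -addrA; congr (_ + _); rewrite (bigD1 z) ?lexx //=; congr (_ + _).
    by apply: eq_bigl => t; rewrite open_left.
  have : \sum_(z | (u <= z < y)%O) (s z * K z + s z * \sum_(t | (z <= t < y)%O) K t) =
      \sum_(z | (u <= z < y)%O) s z * 2 by exact: eq_bigr.
  rewrite big_split /= -big_distrl /=.
  under [X in _ + X = _]eq_bigr do rewrite big_distrr /=.
  rewrite (exchange_big_dep (fun t => (u <= t < y)%O)) /=; last first.
    by move=> z t /andP[uz _] /andP[zt ->]; rewrite (le_trans uz zt).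
  (* The coefficient of $K(t)$ is the alternating sum over $[u,t]$, which is zero unless $t=u$. *)
  rewrite [X in _ + X = _](bigD1 u) ?lexx //= [X in _ + (_ + X) = _]big1 ?addr0; last first.
    move=> t /andP[/andP[ut ty] nt].
    rewrite (eq_bigl (fun z => (u <= z <= t)%O)) => [|z].
      by rewrite -big_distrl /= euler_sum ?mul0r // lt_neqAle eq_sym nt.
    apply/idP/idP => [/andP[/andP[-> _] /andP[-> _]]//|/andP[-> zt]].
    by rewrite zt ty (le_lt_trans zt ty).
  rewrite [X in _ + X = _](big_pred1 u) => [|z]; last first.
    rewrite /=; apply/idP/eqP => [/andP[/andP[uz _] /andP[zu _]]|->]; last by rewrite uy lexx.
    by apply/le_anti; rewrite zu uz.
  have := euler_sum uy; rewrite (bigD1 y) ?lexx ?ltW //=.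
  rewrite (eq_bigl (fun z => (u <= z < y)%O)) => [|z]; last first.
    by rewrite -andbA [(z <= y)%O && _]andbC -lt_neqAle.
  move=> /addr0_eq <-; rewrite (bigD1 u) ?lexx //= (eq_bigl _ _ (open_left u y)) => E2.
  rewrite sumrN.
  have sy : s y * s y = 1 by rewrite -expr2 sqrr_sign.
  under eq_bigr do rewrite mulrAC; rewrite -big_distrl /=.
  move: E2; set A := \sum_(_ | _) _ => E2.
  move: {K K1 D} (s u) (s y) (K u) A sy E2 => a b k A bb E2.
  have -> : A = - b * 2 - a * k *+ 2 by rewrite -E2 mulr2n; ring.
  by rewrite -[RHS]mul1r -bb; ring.
(* Two solutions of one recursion agree, by induction on the rank distance to $y$. For odd $m$ the
   two signs at $x$ and $y$ coincide, whence $K(x)=-K(x)$. *)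
have KK u : (u < y)%O -> K u = - (s u * s y * K u).
  have [k] := ubnP (rho y - rho u); elim: k u => // k IH u; rewrite ltnS => le_k uy.
  have := etrans (K1 u uy) (esym (K2 u uy)); rewrite (eq_bigr (fun z => - (s z * s y * K z))).
    by move=> /addIr; rewrite -[LHS]mulr_natl -[RHS]mulr_natl => /mulfI; apply; rewrite pnatr_eq0.
  move=> z /andP[uz zy]; apply: IH => //; apply: leq_trans le_k.
  have := rho_lt uz; have := rho_lt zy; lia.
move=> xy ry om; have := KK x xy; rewrite /K ry addKn => E.
have : s x * s y = 1 by rewrite ry -exprD addSn addnS addnA -signr_odd /= oddD addnn odd_double om.
by move=> s1; move: E; rewrite -[in X in _ = - (X * _)]ry s1 mul1r; lra.
Qed.

End EulerianIntervals.

(** * Words of the flag forms *)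

Section FlagForms.
Variables (R : realFieldType).

(** The word of $L_S$ up to sign: ranks outside $S$ are forced, ranks in $S$ are optional, and each
    chosen element weighs $-1/2$. *)
Definition sparse_letter (o : bool) : R * R := if o then @opt_letter R else (0, - 2^-1).
Definition sparse_sign (o : bool) : R := if o then 1 else -1.
Definition half_sign (o : bool) : R := if o then - 2^-1 else 1.

(* 0 stands for a rank outside V, 1 for one in M, 2 for one in V \ M. *)
Definition code_letter (k : nat) : R * R :=
  match k with 0 => (0, 2^-1) | 1 => @opt_letter R | _ => (1, 0) end.

Fixpoint codes_between (m v : bitseq) : seq nat :=
  match m, v with
  | a :: m', b :: v' => (if a then 1 else if b then 2 else 0)%N :: codes_between m' v'
  | _, _ => [::]
  end.

(** The sign of a rank outside $Q$ is absorbed into its letter, which becomes $(0,1/2)$. A rank of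
    $V\setminus M$ receives both letters, and $(1,-1/2)+(0,1/2)=(1,0)$. *)
Lemma word_between_sparse m v :
  word_between sparse_letter sparse_sign m v = map code_letter (codes_between m v).
Proof.
elim: m v => [|a m IH] [|b v] //=; rewrite IH; congr cons.
by case: a b => [] []; rewrite /letter_sum /= ?big_cons ?big_nil /=; congr pair; field.
Qed.

Lemma word_between_half b :
  word_between (@bit_letter R) half_sign (map negb b) (nseq (size b) true) =
  map sparse_letter b.
Proof.
elim: b => [|a b IH] //=; rewrite IH; congr cons.
by case: a; rewrite /letter_sum /= ?big_cons ?big_nil /=; congr pair; field.
Qed.

Lemma prod_half_sign b : \prod_(o <- b) half_sign o = (- 2^-1) ^+ count id b.
Proof.
elim: b => [|o b IH]; rewrite ?big_nil ?big_cons //= IH.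
by case: o; rewrite ?mul1r // exprS.
Qed.

Lemma prod_sparse_sign b : \prod_(o <- b) sparse_sign o = (-1) ^+ (size b - count id b).
Proof.
elim: b => [|o b IH]; rewrite ?big_nil ?big_cons //= IH.
by case: o; rewrite ?mul1r //= add0n subSn ?count_size // exprS.
Qed.

End FlagForms.

(* The word of an admissible pair inside a maximal interval of V; the first
   component tells whether M is empty there, at the left or at the right end. *)
Definition block_codes (b : nat * nat) : seq nat :=
  match b.1 with
  | 0 => nseq b.2 2
  | 1 => [:: 1; 1] ++ nseq b.2 2
  | _ => nseq b.2 2 ++ [:: 1; 1]
  end%N.

(** Two blocks are always separated by exactly one rank outside $V$. The empty block [(0, 0)] stands
    between consecutive ranks outside $V$ and at an end of $[1,n]$ that lies outside $V$. *)
Fixpoint blocks_codes (b : nat * nat) (bs : seq (nat * nat)) : seq nat :=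
  if bs is b' :: bs' then block_codes b ++ 0%N :: blocks_codes b' bs' else block_codes b.

Definition signed_blocks (bs : seq (nat * nat)) : nat := count (fun b => b.1 != 0%N) bs.

(* [odd_run] is the parity of the run that precedes [b]. *)
Fixpoint even_runs (odd_run : bool) (b : bitseq) : bool :=
  if b is o :: b' then if o then even_runs (~~ odd_run) b' else ~~ odd_run && even_runs false b'
  else ~~ odd_run.

(** * Signs and vanishing of chain sums in Eulerian posets *)

Section EulerianForms.
Variables (R : realFieldType) (d : Order.disp_t) (P : finTBPOrderType d).
Variable rho : P -> nat.
Hypothesis rhoP : rank_function rho.
Hypothesis eP : eulerian rho.
Local Notation chain_sum := (@chain_sum R d P rho).
Let rho_lt := rank_function_homo rhoP.

Lemma chain_sum_skip (x y : P) r k w :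
  chain_sum x y r (nseq k (1, 0) ++ w) = chain_sum x y (r + k) w.
Proof. by elim: k r => [|k IH] r /=; rewrite ?addn0 // mul1r mul0r addr0 IH addSnnS. Qed.

Lemma chain_sum_free (x y : P) r k : chain_sum x y r (nseq k (1, 0)) = 1.
Proof. by rewrite -[nseq _ _]cats0 chain_sum_skip. Qed.

(** Let $a$ and $b$ be the numbers of elements on the two optional ranks. Each of the $b$ upper
    elements has exactly two of the lower ones below it, so there are $2b$ chains with two elements.
    The sum $1-a/2-b/2+2b/4$ no longer depends on $b$. *)
Lemma chain_sum_left (x y : P) k : rho y = ((rho x).+1 + (2 + k))%N ->
  chain_sum x y (rho x).+1 ([:: opt_letter R; opt_letter R] ++ nseq k (1, 0)) =
  1 - 2^-1 * #|[pred z : P | (x < z < y)%O && (rho z == (rho x).+1)]|%:R.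
Proof.
move=> ry /=; rewrite !mul1r chain_sum_free.
under eq_bigr do rewrite chain_sum_free.
under [X in _ + _ * X]eq_bigr => z _ do
  (rewrite chain_sum_free; under eq_bigr do rewrite chain_sum_free).
rewrite big_split /= -[X in _ + _ * (_ + X)]big_distrr /=.
rewrite (exchange_big_dep (fun t => (x < t < y)%O && (rho t == (rho x).+2))) /=; last first.
  by move=> z t /andP[/andP[xz _] _] /andP[/andP[zt ->] ->]; rewrite (lt_trans xz zt).
rewrite [X in _ + _ * (_ + _ * X)](eq_bigr (fun=> 2%:R)) => [|t /andP[/andP[xt ty] /eqP rt]]; last first.
  rewrite sumr_const -(eulerian_thin R rhoP eP xt rt); congr (_%:R); apply: eq_card => z.
  rewrite !inE unfold_in /= rt eqxx andbT; apply/idP/idP => [/andP[/andP[/andP[-> _] ->] /andP[-> _]]//|].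
  by move=> /andP[/andP[-> zt] ->]; rewrite zt ty (lt_trans zt ty).
rewrite !sumr_const; set a := #|_|; set b := #|_|; move: a b => a b.
rewrite -![2%:R *+ _]mulr_natr; field; done.
Qed.

(** A chosen element of the lower optional rank sees exactly two coatoms above it, so it contributes
    a factor $1-2/2=0$; only the choice of a coatom remains. *)
Lemma chain_sum_right (x y : P) r k : rho y = (r + k).+2 ->
  chain_sum x y r (nseq k (1, 0) ++ [:: opt_letter R; opt_letter R]) =
  1 - 2^-1 * #|[pred z : P | (x < z < y)%O && (rho z == (r + k).+1)]|%:R.
Proof.
move=> ry; rewrite chain_sum_skip /= !mul1r.
rewrite [X in _ + _ * X]big1 => [|z /andP[/andP[xz zy] /eqP rz]].
  by rewrite mulr0 addr0 sumr_const mulNr.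
rewrite sumr_const -rz (eulerian_thin R rhoP eP) ?ry ?rz //; field; done.
Qed.

Lemma chain_sum_block_ge0 (x y : P) b : (x < y)%O ->
  rho y = ((rho x).+1 + size (block_codes b))%N ->
  0 <= (-1) ^+ (b.1 != 0%N) * chain_sum x y (rho x).+1 (map (@code_letter R) (block_codes b)).
Proof.
case: b => [[|[|j]] k] xy /=.
- by rewrite size_nseq map_nseq chain_sum_free mul1r.
- rewrite size_nseq map_nseq => ry; have /= -> := @chain_sum_left x y k ry.
  have /(eulerian_atoms R rhoP eP xy) : ((rho x).+1 < rho y)%N by rewrite ry; lia.
  by rewrite -(ler_nat R) expr1; lra.
rewrite size_cat size_nseq map_cat map_nseq /= => ry.
have {}ry : rho y = ((rho x).+1 + k).+2 by rewrite ry; lia.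
rewrite (chain_sum_right _ ry).
have /(eulerian_coatoms R rhoP eP xy) := ry.
have lt : (rho x < ((rho x).+1 + k).+1)%N by lia.
move=> /(_ lt).
by rewrite -(ler_nat R) expr1; lra.
Qed.

Lemma chain_sum_blocks_ge0 (x y : P) b bs : (x < y)%O ->
  rho y = ((rho x).+1 + size (blocks_codes b bs))%N ->
  0 <= (-1) ^+ signed_blocks (b :: bs) *
       chain_sum x y (rho x).+1 (map (@code_letter R) (blocks_codes b bs)).
Proof.
elim: bs b x => [|b' bs IH] b x xy ry; first by rewrite /signed_blocks /= addn0 chain_sum_block_ge0.
rewrite /= map_cat chain_sum_cat size_map /signed_blocks /= mulrCA exprD.
rewrite mulr_ge0 ?invr_ge0 ?ler0n // big_distrr sumr_ge0 //= => z /andP[/andP[xz zy] /eqP rz].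
rewrite mulrACA -rz mulr_ge0 //; first exact: chain_sum_block_ge0.
by apply: IH => //; rewrite ry rz /= size_cat /=; lia.
Qed.

(** Here [k] is the length of the run of optional ranks read since the last cut. A forced rank or
    the end of the word closes the run, and an odd closed run contributes a zero factor. *)
Lemma chain_sum_sparse0 (x y : P) k b : (x < y)%O ->
  rho y = ((rho x).+1 + (k + size b))%N -> ~~ even_runs (odd k) b ->
  chain_sum x y (rho x).+1 (nseq k (opt_letter R) ++ map (@sparse_letter R) b) = 0.
Proof.
elim: b k x => [|[] b IH] k x xy ry /=.
- by rewrite negbK cats0 => ok; apply: eulerian_chain_sum0; rewrite ?ry ?addn0.
- move=> ev; rewrite -cat1s catA -[[:: _]]/(nseq 1 (opt_letter R)) -nseqD addn1.
  by apply: IH => //; rewrite ry /=; lia.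
move=> ev; rewrite chain_sum_cat big1 ?mulr0 // => z /andP[/andP[xz zy] /eqP].
rewrite size_nseq => rz; move: ev; rewrite negb_and negbK => /orP[ok|ev].
  by rewrite (eulerian_chain_sum0 R rhoP eP xz) ?mul0r ?rz.
rewrite -rz [X in _ * X](IH 0%N) ?mulr0 //.
by rewrite ry rz /=; lia.
Qed.

End EulerianForms.

Lemma flag_coord_mk (R : realType) n (f : {set 'I_n} -> R) S :
  flag_coord (mk_flag f) S = f S.
Proof. by rewrite /flag_coord mxE enum_rankK. Qed.

Lemma flagL_bits (R : realType) n b (v : flag_space R n) : size b = n ->
  flagL (set_of_bits n b) v =
  (\prod_(o <- b) sparse_sign R o) *
  \sum_(t <- bits_between (map negb b) (nseq n true))
     (\prod_(o <- t) half_sign R o) * flag_coord v (set_of_bits n t).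
Proof.
move=> sb; rewrite /flagL prod_sparse_sign card_set_of_bits // sb; congr (_ * _).
rewrite setC_bits //.
rewrite (eq_bigl (fun T : {set 'I_n} => (set_of_bits n (map negb b) \subset T) && (T \subset set_of_bits n (nseq n true)))); last first.
  by move=> T; rewrite set_of_nseq_true finset.subsetT andbT.
rewrite sum_set_bits ?size_map ?size_nseq // ?implb_nseq_true ?size_map //.
apply: eq_big_seq => t /size_mem_bits_between; rewrite size_map size_nseq sb => /(_ (erefl _)).
by rewrite implb_nseq_true ?size_map // => /(_ isT) st; rewrite prod_half_sign card_set_of_bits.
Qed.

Definition facet_form (R : realType) n (m v : bitseq) (x : flag_space R n) : R :=
  (-1) ^+ (#|set_of_bits n m|./2) *
  \sum_(Q : {set 'I_n} | (set_of_bits n m \subset Q) && (Q \subset set_of_bits n v)) flagL Q x.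

Section EulerianFlags.
Variables (R : realType) (n : nat) (d : Order.disp_t) (P : finTBPOrderType d).
Variable rho : P -> nat.
Hypothesis rhoP : rank_function rho.
Hypothesis rho_top : rho (Order.top : P) = n.+1.
Hypothesis eP : eulerian rho.
Local Notation fv := (flag_vector R n rho).
Let rho_lt := rank_function_homo rhoP.
Local Notation csum := (@chain_sum R d P rho (Order.bottom : P) (Order.top : P) 1).

Let bot_lt_top : ((Order.bottom : P) < Order.top)%O.
Proof.
rewrite lt_neqAle Order.le0x andbT; apply/eqP => E.
by move: rho_top; rewrite -E rhoP.1.
Qed.

Lemma flagL_chain_sum b : size b = n ->
  flagL (set_of_bits n b) fv =
  (\prod_(o <- b) sparse_sign R o) * csum (map (@sparse_letter R) b).
Proof.
move=> sb; rewrite flagL_bits // -word_between_half sb -sum_bits_between ?size_map ?size_nseq //.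
congr (_ * _); apply: eq_big_seq => t /size_mem_bits_between.
rewrite size_map size_nseq implb_nseq_true ?size_map // => /(_ sb isT) st.
rewrite flag_coord_mk (flag_number_chain_sum R rho_lt _ (x := Order.bottom) (y := Order.top)) //.
all: by rewrite ?set_of_bitsK ?st ?rhoP.1 // => z; rewrite ?Order.le0x ?Order.lex1.
Qed.

Lemma flagL_eulerian0 b : size b = n -> ~~ even_runs false b ->
  flagL (set_of_bits n b) fv = 0.
Proof.
move=> sb ev; rewrite flagL_chain_sum //.
have := chain_sum_sparse0 R rhoP eP (k := 0) bot_lt_top _ ev.
by rewrite rho_top rhoP.1 sb => /(_ (erefl _)) /= ->; rewrite mulr0.
Qed.

Lemma facet_form_eulerian_ge0 m v b bs : size m = n -> size v = n -> all2 implb m v ->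
  codes_between m v = blocks_codes b bs -> odd (count id m)./2 = odd (signed_blocks (b :: bs)) ->
  0 <= facet_form m v fv.
Proof.
move=> sm sv mv cE sg; rewrite /facet_form sum_set_bits // card_set_of_bits //.
rewrite -signr_odd sg signr_odd.
under eq_big_seq => t /size_mem_bits_between st do
  rewrite flagL_chain_sum ?st ?sm ?sv //.
rewrite sum_bits_between ?sm ?sv // word_between_sparse cE.
have := @chain_sum_blocks_ge0 R _ _ _ rhoP eP _ _ b bs bot_lt_top.
rewrite rho_top rhoP.1; apply; rewrite -cE add1n; congr _.+1.
by elim: (m) v n sm sv {mv cE sg} => [|a m' IH] [|c v] [|k] //= [sm] [sv]; rewrite -(IH v k).
Qed.

End EulerianFlags.

(** * The $L$-vector as a system of linear coordinates *)

Section Inversion.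
Variables (R : realType) (n : nat).
Implicit Types v : flag_space R n.

Lemma flagL_is_linear (S : {set 'I_n}) : linear (@flagL R n S : flag_space R n -> R^o).
Proof.
move=> a u v; rewrite /flagL scalerAr scaler_sumr -mulrDr -big_split /=; congr (_ * _).
by apply: eq_bigr => T _; rewrite /flag_coord !mxE mulrDr mulrCA.
Qed.

HB.instance Definition _ (S : {set 'I_n}) :=
  GRing.isLinear.Build R (flag_space R n) R^o *%R (@flagL R n S) (flagL_is_linear S).

Lemma facet_form_is_linear (m v : bitseq) :
  linear (@facet_form R n m v : flag_space R n -> R^o).
Proof.
move=> a x y; rewrite /facet_form scalerAr scaler_sumr -mulrDr -big_split /=; congr (_ * _).
by apply: eq_bigr => Q _; rewrite linearP.
Qed.

HB.instance Definition _ (m v : bitseq) :=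
  GRing.isLinear.Build R (flag_space R n) R^o *%R (@facet_form R n m v) (facet_form_is_linear m v).

(** $L_{[1,n]\setminus T}$ involves only the $f_U$ with $U\supseteq T$, with a nonzero coefficient
    at $U=T$. The system is triangular and is solved from the largest $T$ downwards. *)
Lemma flagL_inj u v :
  (forall b, b \in all_bits n -> flagL (set_of_bits n b) u = flagL (set_of_bits n b) v) -> u = v.
Proof.
move=> H; have E S : flagL S u = flagL S v.
  have sS := size_bits_of_set S; rewrite -(bits_of_setK S); apply: H.
  rewrite mem_bits_between ?implb_nseq_true ?size_nseq //.
  by rewrite sS eqxx implb_nseq_false // implb_nseq_true.
suff C T : flag_coord u T = flag_coord v T.
  by apply/matrixP => i j; rewrite (ord1 i); have := C (enum_val j); rewrite /flag_coord enum_valK.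
have [k] := ubnP #|~: T|%SET; elim: k T => // k IH T; rewrite ltnS => le_k.
have := E (~: T)%SET; rewrite /flagL finset.setCK => /mulfI.
rewrite expf_eq0 oppr_eq0 oner_eq0 andbF => /(_ isT).
rewrite (bigD1 T) //= [RHS](bigD1 T) //= => E1.
have E2 : \sum_(U : {set 'I_n} | (T \subset U) && (U != T)) (- 2^-1) ^+ #|U| * flag_coord u U
    = \sum_(U : {set 'I_n} | (T \subset U) && (U != T)) (- 2^-1) ^+ #|U| * flag_coord v U.
  apply: eq_bigr => U /andP[TU nUT]; rewrite IH //; apply: leq_trans le_k.
  by apply: proper_card; rewrite finset.properC finset.properEneq eq_sym nUT.
move: E1; rewrite E2 => /addIr /mulfI; apply.
by rewrite expf_eq0 oppr_eq0 invr_eq0 pnatr_eq0 andbF.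
Qed.

End Inversion.

(** * Duplicated posets *)

Section DupPoset.
Variables (a b N : nat) (P : ranked_poset).
Local Notation D := (dup_poset a b N P).
Local Notation inside k := (a <= k <= b)%N.

Lemma dup_ltE (u v : D) : (u < v)%O = (tag u < tag v)%O &&
  (inside (rk (tag u)) && inside (rk (tag v)) ==> (tagged u == tagged v :> nat)).
Proof.
apply/idP/andP => [uv|[uv H]].
  have /andP[le_uv ->] := ltW uv.
  split => //; rewrite lt_neqAle le_uv andbT; apply/eqP => E.
  by have := rk_homo uv; rewrite /= /dup_rk E ltnn.
rewrite lt_neqAle; apply/andP; split; last first.
  by rewrite /Order.le /= /dup_le (ltW uv) H.
by apply/eqP => E; move: uv; rewrite E ltxx.
Qed.

(** The copy of $t$ is free only if neither end lies in the duplicated interval: an end inside it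
    fixes the index, and if both are inside, $u\le v$ makes their indices equal. *)
Lemma card_dup_fiber (u v : D) (t : P) : (u <= v)%O ->
  #|[pred i : 'I_(if inside (rk t) then N else 1) |
      (inside (rk (tag u)) && inside (rk t) ==> (tagged u == i :> nat)) &&
      (inside (rk t) && inside (rk (tag v)) ==> (i == tagged v :> nat))]| =
  if [&& inside (rk t), ~~ inside (rk (tag u)) & ~~ inside (rk (tag v))] then N else 1%N.
Proof.
move=> /andP[_ uv]; case: (boolP (inside (rk t))) => ct /=; last first.
  rewrite andbF -[RHS](card_ord 1); apply: eq_card => i; by rewrite inE.
rewrite andbT; case: u v uv => [x i] [y j] /=.
case: (boolP (inside (rk x))) i => cx i /=; case: (boolP (inside (rk y))) j => cy j /= uv.
- rewrite -(card1 i); apply: eq_card => k; rewrite !inE eq_sym -(eqP uv).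
  by rewrite andbb.
- by rewrite -(card1 i); apply: eq_card => k; rewrite !inE andbT eq_sym.
- by rewrite -(card1 j); apply: eq_card => k; rewrite !inE.
- by rewrite -[RHS]card_ord; apply: eq_card => k; rewrite !inE.
Qed.

Lemma sum_dup (R : nmodType) (u v : D) k (F : P -> R) : (u <= v)%O ->
  \sum_(z : D | (u < z < v)%O && (rk z == k)) F (tag z) =
  (\sum_(t | (tag u < t < tag v)%O && (rk t == k)) F t) *+
  (if [&& inside k, ~~ inside (rk (tag u)) & ~~ inside (rk (tag v))] then N else 1%N).
Proof.
move=> uv; rewrite -sumrMnl.
pose fiber (t : P) := [pred i : 'I_(if inside (rk t) then N else 1) |
  (inside (rk (tag u)) && inside (rk t) ==> (tagged u == i :> nat)) &&
  (inside (rk t) && inside (rk (tag v)) ==> (i == tagged v :> nat))].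
transitivity (\sum_(t | (tag u < t < tag v)%O && (rk t == k)) \sum_(i | fiber t i) F t).
  rewrite (sig_big_dep _ fiber (fun t _ => F t)) /=.
  apply: eq_bigl => z; rewrite !dup_ltE /= /dup_rk.
  by case: (tag u < tag z)%O; case: (tag z < tag v)%O; rewrite ?andbF //= andbC.
by apply: eq_bigr => t /andP[_ /eqP <-]; rewrite sumr_const (card_dup_fiber t uv).
Qed.

End DupPoset.

Definition bounds_of n (P : ranked_poset) (x y : P) : Prop :=
  [/\ forall z, (x <= z)%O, forall z, (z <= y)%O, rk x = 0%N & rk y = n.+1].

Lemma dup_bounds n a b N (P : ranked_poset) (x y : P) : (0 < a)%N -> (b <= n)%N ->
  bounds_of n x y ->
  exists x' y' : dup_poset a b N P, [/\ bounds_of n x' y', tag x' = x & tag y' = y].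
Proof.
move=> a0 bn [xmin ymax rx ry].
have cx : (a <= rk x <= b)%N = false by rewrite rx leqNgt a0.
have cy : (a <= rk y <= b)%N = false by rewrite ry andbC leqNgt ltnS bn.
have E c : c = false -> (0 < if c then N else 1)%N by move=> ->.
exists (existT _ x (Ordinal (E _ cx)) : dup_poset a b N P).
exists (existT _ y (Ordinal (E _ cy)) : dup_poset a b N P); split=> //; split=> // z.
  by apply/andP; rewrite /= cx xmin.
by apply/andP; rewrite /= cy andbF ymax.
Qed.

Section DupChainSum.
Variables (R : comNzRingType) (n a b N : nat) (P : ranked_poset).
Variables (x y : P) (y' : dup_poset a b N P).
Hypotheses (bn : (b <= n)%N) (yP : forall z, (z <= y')%O) (ty : tag y' = y) (ry : rk y = n.+1).

(** The lowest chain element in the duplicated interval has $N$ copies to choose from, and the later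
    ones there must carry the same index. If $u$ already has rank at least $a$, no free choice is
    left. *)
Lemma dup_chain_sum (u : dup_poset a b N P) r bs : (rk u < r)%N ->
  chain_sum (@rk _) u y' r (map (@bit_letter R) bs) =
  (if (rk u < a)%N && has (fun k => a <= k <= b)%N (positions r bs) then N else 1%N)%:R
  * chain_sum (@rk _) (tag u) y r (map (@bit_letter R) bs).
Proof.
elim: bs u r => [|o bs IH] u r ur; first by rewrite /= andbF mulr1.
case: o => /=; last by rewrite !mul1r !mul0r !addr0 IH // ltnW.
rewrite !mul0r !add0r !mul1r.
have far k s : (b < k)%N -> has (fun k => a <= k <= b)%N (positions k s) = false.
  elim: s k => [|o s IHs] k bk //=; rewrite has_cat IHs ?leqW // orbF.
  by case: o; rewrite //= [(k <= b)%N]leqNgt bk andbF.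
pose c := (if (r < a)%N && has (fun k => a <= k <= b)%N (positions r.+1 bs) then N else 1%N).
transitivity (\sum_(z | (u < z < y')%O && (rk z == r))
   (c%:R * chain_sum (@rk _) (tag z) y r.+1 (map (@bit_letter R) bs))).
  by apply: eq_bigr => z /andP[_ /eqP rz]; rewrite IH /= rz ?ltnSn.
rewrite (@sum_dup a b N P _ u y' r
  (fun t => c%:R * chain_sum (@rk _) t y r.+1 (map (@bit_letter R) bs))) // ty.
rewrite -big_distrr /= -mulrnAl -mulr_natr -natrM; congr (_%:R * _).
have -> : (a <= rk y <= b)%N = false by rewrite ry; lia.
rewrite andbT /c; have /= -> : rk (tag u) = rk u by [].
have [rb|br] := leqP r b.
  rewrite andbT; case: (leqP a r) => ar /=.
    have ub := ltnW (leq_trans ur rb); rewrite /= in ub *.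
    by rewrite mul1n ub andbT -ltnNge andbT.
  by rewrite muln1 (ltn_trans ur ar).
have fr := far r.+1 bs (leqW br).
by rewrite fr !andbF muln1.
Qed.

End DupChainSum.

(** Each interval carries its own multiplicity because the doubled posets mix the multiplicities 2
    and $N$. *)
Definition iter_dup n (L : seq (nat * nat * nat)) : ranked_poset :=
  foldr (fun p P => dup_poset p.1.1 p.1.2 p.2 P) (chain_poset n) L.

Lemma chain_poset_chain_sum (R : comNzRingType) n (x y : chain_poset n) r bs :
  (x < r)%N -> (r + size bs <= y)%N ->
  chain_sum (@rk (chain_poset n)) x y r (map (@bit_letter R) bs) = 1.
Proof.
elim: bs x r => [|o bs IH] x r //= xr; rewrite addnS => ry.
case: o => /=; last by rewrite mul1r mul0r addr0 IH // ltnW.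
have rn : (r < n.+2)%N by apply: leq_ltn_trans (ltn_ord y); apply: leq_trans ry; lia.
rewrite mul0r mul1r add0r (big_pred1 (Ordinal rn)) => [|z /=]; first by rewrite IH.
rewrite -(inj_eq val_inj) /=; apply/andb_idl => /eqP E.
apply/andP; split; [change (nat_of_ord x < nat_of_ord z)%N | change (nat_of_ord z < nat_of_ord y)%N].
  by rewrite E.
by rewrite E; apply: leq_trans ry; rewrite ltnS leq_addr.
Qed.

Definition dup_factor (i j k : nat) (p : nat * nat * nat) : nat :=
  if [&& p.1.1 <= k <= p.1.2, i < p.1.1 & p.1.2 < j]%N then p.2 else 1%N.

Definition hit_factor (bs : bitseq) (p : nat * nat * nat) : nat :=
  if has (fun k => p.1.1 <= k <= p.1.2)%N (positions 1 bs) then p.2 else 1%N.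

(** The last clause says that the number of elements of a given rank in $(u,v)$ depends on the ranks
    of $u$ and $v$ only, which turns the Eulerian condition into arithmetic on ranks. *)
Lemma iter_dupP (R : comNzRingType) n L :
  all (fun p => (0 < p.1.1)%N && (p.1.2 <= n)%N) L ->
  exists x y : iter_dup n L,
  [/\ bounds_of n x y,
      forall bs, size bs = n ->
        chain_sum (@rk _) x y 1 (map (@bit_letter R) bs) = (\prod_(p <- L) hit_factor bs p)%:R &
      forall (u v : iter_dup n L) k, (u < v)%O -> (rk u < k < rk v)%N ->
        \sum_(z | (u < z < v)%O && (rk z == k)) 1 = \prod_(p <- L) dup_factor (rk u) (rk v) k p].
Proof.
elim: L => [|[[a b] N] L IH] /=.
  move=> _; exists (ord0 : chain_poset n), (ord_max : chain_poset n); split.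
  - by split=> // z; change (nat_of_ord z <= n.+1)%N; rewrite -ltnS.
  - by move=> bs sb; rewrite chain_poset_chain_sum ?big_nil ?sb.
  move=> u v k _ /andP[uk kv]; rewrite big_nil.
  have kn : (k < n.+2)%N by apply: ltn_trans (ltn_ord v).
  rewrite (big_pred1 (Ordinal kn)) // => z /=.
  rewrite -(inj_eq val_inj) /=; apply/andb_idl => /eqP E.
  by apply/andP; split; [change (nat_of_ord u < nat_of_ord z)%N | change (nat_of_ord z < nat_of_ord v)%N]; rewrite E.
move=> /andP[/andP[a0 bn] aL]; have [x [y [bxy cs ct]]] := IH aL.
have [x' [y' [bxy' tx ty]]] := dup_bounds N a0 bn bxy.
exists x', y'; split=> //.
  move=> bs sb; case: bxy' => _ y'max rx' _; case: (bxy) => _ _ _ ry.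
  rewrite (dup_chain_sum R bn y'max ty ry) rx' // tx cs // big_cons natrM a0.
  by [].
move=> u v k uv kk; rewrite (@sum_dup a b N _ nat u v k (fun=> 1%N)) ?ltW //.
have tuv : (tag u < tag v)%O by move: uv; rewrite dup_ltE => /andP[].
rewrite (ct _ _ k tuv) // big_cons mulrC /dup_factor /=.
case/andP: kk; rewrite /= /dup_rk => uk kv; rewrite -mulr_natr natn; congr (_ * _).
case: (boolP (a <= k <= b)%N) => //= /andP[ak kb].
have -> : (a <= rk (tag u) <= b)%N = ~~ (rk (tag u) < a)%N.
  by rewrite -leqNgt andb_idr // => _; apply: leq_trans (ltnW uk) kb.
have -> : (a <= rk (tag v) <= b)%N = ~~ (b < rk (tag v))%N.
  by rewrite -leqNgt andb_idl // => _; apply: leq_trans ak (ltnW kv).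
by rewrite !negbK.
Qed.

(** * Doubled limit posets *)

Lemma eulerian_of_sums (d : Order.disp_t) (P : finTBPOrderType d) (rho : P -> nat) :
  (forall x y : P, (x < y)%O -> (rho x < rho y)%N) ->
  (forall x y : P, (x < y)%O -> \sum_(z | (x <= z <= y)%O) (-1) ^+ rho z = 0 :> int) ->
  eulerian rho.
Proof.
move=> rho_lt sum0 x y.
have [k] := ubnP (rho y - rho x); elim: k y => // k IH y; rewrite ltnS => le_k.
rewrite le_eqVlt => /predU1P[<-|xy]; first by rewrite mobiusE eqxx subnn.
rewrite mobiusE (lt_eqF xy).
have E z : (x <= z < y)%O -> mobius x z = (-1) ^+ rho x * (-1) ^+ rho z.
  move=> /andP[xz zy]; rewrite IH //; last first.
    apply: leq_trans le_k; rewrite ltn_sub2r ?rho_lt //; exact: le_lt_trans zy.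
  have le : (rho x <= rho z)%N by move: xz; rewrite le_eqVlt => /predU1P[->//|/rho_lt/ltnW].
  by rewrite -[in RHS](subnKC le) exprD mulrA -expr2 sqrr_sign mul1r.
rewrite (eq_bigr _ E) -big_distrr /= -mulrN.
have := sum0 _ _ xy; rewrite (bigD1 y) ?lexx ?ltW //=.
rewrite (eq_bigl (fun z => (x <= z < y)%O)) => [|z]; last first.
  by rewrite -andbA [(z <= y)%O && _]andbC -lt_neqAle.
move=> /eqP; rewrite addrC addr_eq0 => /eqP ->; rewrite opprK.
have le := ltnW (rho_lt _ _ xy).
by rewrite -[in LHS](subnKC le) exprD mulrA -expr2 sqrr_sign mul1r.
Qed.

Lemma ranked_poset_eulerian (R : realType) n (P : ranked_poset) (x y : P) :
  bounds_of n x y ->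
  (forall u v : P, (u < v)%O -> ((rk u).+1 < rk v)%N -> exists z, (u < z < v)%O) ->
  (forall u v : P, (u < v)%O -> \sum_(z | (u <= z <= v)%O) (-1) ^+ rk z = 0 :> int) ->
  @eulerian_flag_vectors R n (flag_vector R n (@rk P)).
Proof.
move=> [xmin ymax rx ry] between sum0.
(* The bounds are packed onto the carrier of [P] with its own order, so the flag vector is that of
   [P] itself. *)
pose TB : finTBPOrderType (rp_disp P) := HB.pack (Order.FinPOrder.sort P)
  (Order.hasBottom.Build _ _ xmin) (Order.hasTop.Build _ _ ymax).
exists (rp_disp P), TB, (@rk P); split=> //.
  split=> // u v /andP[uv /forallP nb]; apply/eqP; rewrite eqn_leq (rk_homo uv) andbT leqNgt.
  by apply/negP => /(between _ _ uv) [z uzv]; have := nb z; rewrite uzv.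
by apply: eulerian_of_sums => [u v|u v]; [exact: rk_homo | exact: sum0].
Qed.

Definition cover_count (J : seq (nat * nat)) (i j k : nat) : nat :=
  count (fun p => [&& p.1 <= k <= p.2, i < p.1 & p.2 < j]%N) J.

(* The coefficient of N^e in the alternating sum over the ranks of an interval
   of P(n, J, N) between ranks i and j is zero for e > 0. *)
Definition balanced n (J : seq (nat * nat)) : bool :=
  all (fun e => all (fun i => all (fun j =>
    count (fun k => (cover_count J i j k == e) && odd k) (index_iota i.+1 j) ==
    count (fun k => (cover_count J i j k == e) && ~~ odd k) (index_iota i.+1 j))
  (iota 0 n.+2)) (iota 0 n.+2)) (iota 1 (size J)).

Lemma sum_sign_count (P : pred nat) (s : seq nat) :
  \sum_(k <- s | P k) (-1) ^+ k =
  (count (fun k => P k && ~~ odd k) s)%:R - (count (fun k => P k && odd k) s)%:R :> int.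
Proof.
elim: s => [|k s IH]; first by rewrite big_nil subrr.
by rewrite big_cons IH /= -signr_odd; case: (P k) => //=; case: (odd k); rewrite /= !natrD; ring.
Qed.

Lemma balanced_sum n J N i j : balanced n J -> (i < n.+2)%N -> (j < n.+2)%N ->
  \sum_(i.+1 <= k < j) (-1) ^+ k * (N ^ cover_count J i j k)%:R =
  \sum_(i.+1 <= k < j) (-1) ^+ k :> int.
Proof.
move=> bJ ni nj; apply/eqP; rewrite -subr_eq0 -sumrB.
under eq_bigr do rewrite -[X in _ - X]mulr1 -mulrBr.
(* Ranks are grouped by the exponent $e$ of $N$. The group $e=0$ carries the factor $N^0-1=0$; every
   other group has as many odd as even ranks. *)
rewrite (partition_big (fun k => inord (cover_count J i j k) : 'I_(size J).+1) xpredT) //=.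
apply/eqP; apply: big1 => e _.
transitivity (\sum_(k <- index_iota i.+1 j | cover_count J i j k == e) (-1) ^+ k * ((N ^ e)%:R - 1) : int).
  apply: eq_big => [k|k /eqP <-]; last by rewrite inordK // ltnS count_size.
  by rewrite -(inj_eq val_inj) /= inordK // ltnS count_size.
rewrite -big_distrl /= sum_sign_count.
have [e0|e0] := posnP e; first by rewrite e0 expn0 subrr mulr0.
move/allP: bJ => /(_ (nat_of_ord e)); rewrite mem_iota e0 add1n ltn_ord => /(_ isT).
move/allP => /(_ i); rewrite mem_iota add0n ni => /(_ isT).
move/allP => /(_ j); rewrite mem_iota add0n nj => /(_ isT) /eqP ->.
by rewrite subrr mul0r.
Qed.

(** The alternating sum over an interval with two elements on every inner rank, which is the case
    $N=1$ of the doubled poset. *)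
Lemma sum_sign_range i j : (i < j)%N ->
  (-1) ^+ i + (-1) ^+ j + 2 * \sum_(i.+1 <= k < j) (-1) ^+ k = 0 :> int.
Proof.
elim: j => // j IH; rewrite ltnS leq_eqVlt => /predU1P[->|ij].
  by rewrite big_geq // exprS mulr0 addr0 mulN1r subrr.
rewrite big_nat_recr //= exprS; have := IH ij.
by set a := (-1) ^+ i; set b := (-1) ^+ j; set c := \sum_(_ <= _ < _) _; move: a b c => a b c; lia.
Qed.

Lemma sum_by_rank (T : finType) (Q : pred T) (rho : T -> nat) i j :
  (forall z, Q z -> i < rho z < j)%N ->
  \sum_(z | Q z) (-1) ^+ rho z =
  \sum_(i.+1 <= k < j) (-1) ^+ k * (\sum_(z | Q z && (rho z == k)) 1%N)%:R :> int.
Proof.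
move=> H; under [RHS]eq_bigr do rewrite natr_sum big_distrr /=.
rewrite (exchange_big_dep Q) /=; last by move=> k z _ /andP[].
apply: eq_bigr => z Qz; rewrite big_mkcond /=.
rewrite (bigD1_seq (rho z)) ?iota_uniq ?mem_index_iota ?H //= Qz eqxx mulr1 big1_seq ?addr0 //.
by move=> k /andP[/negbTE nk _]; rewrite eq_sym nk.
Qed.

(** Doubling is itself a duplication, along the interval $[k,k]$ with multiplicity 2 at every rank
    $k$; this accounts for the factor $2^{|S|}$. *)
Definition doubled_list n (J : seq (nat * nat)) N : seq (nat * nat * nat) :=
  [seq (k, k, 2%N) | k <- iota 1 n] ++ [seq (p.1, p.2, N) | p <- J].

Definition itv_ok n (p : nat * nat) := (0 < p.1)%N && (p.2 <= n)%N.

Lemma doubled_list_ok n J N : all (itv_ok n) J ->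
  all (fun p => (0 < p.1.1)%N && (p.1.2 <= n)%N) (doubled_list n J N).
Proof.
move=> aJ; rewrite all_cat !all_map (eq_all (a2 := itv_ok n)) // aJ andbT.
by apply/allP => k; rewrite mem_iota /= add1n.
Qed.

Lemma doubled_factor n J N i j k : (i < k < j)%N -> (j <= n.+1)%N ->
  \prod_(p <- doubled_list n J N) dup_factor i j k p = (2 * N ^ cover_count J i j k)%N.
Proof.
move=> /andP[ik kj] jn; rewrite big_cat !big_map /=; congr (_ * _)%N.
  rewrite (bigD1_seq k) ?iota_uniq ?mem_iota //=; last by rewrite add1n; lia.
  rewrite {1}/dup_factor /= leqnn ik kj big1_seq //= => l /andP[/negbTE nl _].
  by rewrite /dup_factor /= -eqn_leq nl.
elim: J => [|p J IH]; rewrite ?big_nil ?big_cons //= IH /dup_factor /=.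
rewrite /cover_count /=; case: [&& _ & _]; [exact: esym (expnS _ _) | exact: mul1n].
Qed.

(** An open interval has $2N^c$ elements at rank $k$, with $c$ given by [cover_count]. By [balanced]
    the alternating sum does not change when $N$ is replaced by 1, where it vanishes by
    [sum_sign_range]. *)
Lemma doubled_poset_eulerian (R : realType) n J N : (0 < N)%N -> all (itv_ok n) J -> balanced n J ->
  @eulerian_flag_vectors R n (flag_vector R n (@rk (iter_dup n (doubled_list n J N)))) /\
  forall S : {set 'I_n},
    (flag_number (@rk (iter_dup n (doubled_list n J N))) S)%:R =
    (\prod_(p <- doubled_list n J N) hit_factor (bits_of_set S) p)%:R :> R.
Proof.
move=> N0 aJ bJ; have [x [y [bxy cs ct]]] := iter_dupP R (doubled_list_ok N aJ).
have [xmin ymax rx ry] := bxy; split; last first.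
  move=> S; rewrite -cs ?size_bits_of_set //.
  by apply: flag_number_chain_sum => // u v; apply: rk_homo.
have le_rk (v : iter_dup n (doubled_list n J N)) : (rk v <= n.+1)%N by rewrite -ry rk_le.
apply: ranked_poset_eulerian bxy _ _ => u v uv.
  move=> ruv; have := ct u v _ uv (introT andP (conj (ltnSn _) ruv)).
  rewrite doubled_factor ?ltnSn ?ruv // => E.
  case: (pickP (fun z => (u < z < v)%O && (rk z == (rk u).+1))) => [z /andP[uzv _]|none].
    by exists z.
  move: E; rewrite big_pred0 // => /esym/eqP; rewrite muln_eq0 /= expn_eq0.
  by rewrite -leqn0 leqNgt N0.
rewrite (bigD1 u) ?lexx ?ltW //= (bigD1 v) /=; last by rewrite lexx ltW // gt_eqF.
rewrite (eq_bigl (fun z => (u < z < v)%O)) => [|z]; last first.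
  apply/idP/idP => [/andP[/andP[/andP[uz zv] nu] nv]|/andP[uz zv]].
    by rewrite !lt_neqAle uz zv nv eq_sym nu.
  by rewrite !ltW // gt_eqF // lt_eqF.
rewrite (@sum_by_rank _ _ _ (rk u) (rk v)) => [|z /andP[uz zv]]; last by rewrite !rk_homo.
rewrite addrA -[RHS](sum_sign_range (rk_homo uv)) -(balanced_sum N bJ); last 2 first.
- by rewrite ltnS le_rk.
- by rewrite ltnS le_rk.
congr (_ + _); rewrite big_distrr /=; apply: eq_big_nat => k kk.
by rewrite ct // doubled_factor // natrM mulrCA.
Qed.

(** * Flag vectors of limit posets *)

Local Open Scope classical_set_scope.

Lemma closure_ge0 (R : realType) m (l : {scalar 'rV[R]_m}) (A : set 'rV[R]_m) x :
  (forall y, A y -> 0 <= l y) -> closure A x -> 0 <= l x.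
Proof.
move=> lA clA; rewrite leNgt; apply/negP => lx.
(* The summand 1 makes $s$ positive and strictly larger than the Lipschitz constant of $l$ in the
   sup norm, so $l$ stays negative on the ball of radius $-l(x)/s$ around $x$. *)
pose s := 1 + \sum_j `|l (delta_mx 0 j)|.
have s0 : 0 < s by rewrite ltr_pwDl // sumr_ge0.
have e0 : 0 < - l x / s by rewrite divr_gt0 // oppr_gt0.
have [y [Ay xy]] := clA _ (nbhsx_ballx x _ e0).
have {}xy j : `|x ord0 j - y ord0 j| <= - l x / s by case: xy => _ /(_ ord0 j)/ltW.
have E : l (x - y) = \sum_j (x ord0 j - y ord0 j) * l (delta_mx 0 j).
  rewrite {1}(row_sum_delta (x - y)) linear_sum; apply: eq_bigr => j _.
  by rewrite linearZ !mxE.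
have : `|l (x - y)| <= (- l x / s) * \sum_j `|l (delta_mx 0 j)|.
  rewrite E (le_trans (ler_norm_sum _ _ _)) // big_distrr ler_sum //= => j _.
  by rewrite normrM ler_wpM2r.
have lt : (- l x / s) * \sum_j `|l (delta_mx 0 j)| < - l x.
  rewrite -[X in _ < X]mulr1 -mulrA ltr_pM2l ?oppr_gt0 // mulrC ltr_pdivrMr // mul1r /s.
  by rewrite ltrDr.
move=> /le_lt_trans/(_ lt); rewrite linearB /= ltr_norml => /andP[+ _].
have := lA _ Ay; lra.
Qed.

Definition pairs_of n (II : {set 'I_n * 'I_n}) : seq (nat * nat) :=
  [seq ((nat_of_ord p.1).+1, (nat_of_ord p.2).+1) | p <- enum II].

Definition hits (J : seq (nat * nat)) (b : bitseq) : nat :=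
  count (fun p => has (fun k => p.1 <= k <= p.2)%N (positions 1 b)) J.

Lemma prod_hit_factor J N b :
  \prod_(p <- [seq (p.1, p.2, N) | p <- J]) hit_factor b p = (N ^ hits J b)%N.
Proof.
rewrite big_map; elim: J => [|p J IH]; rewrite ?big_nil ?big_cons //= IH /hit_factor /hits /=.
by case: (has _ _); [exact: esym (expnS _ _) | exact: mul1n].
Qed.

Lemma prod_doubled_hit_factor n J N (S : {set 'I_n}) :
  \prod_(p <- doubled_list n J N) hit_factor (bits_of_set S) p =
  (2 ^ #|S| * N ^ hits J (bits_of_set S))%N.
Proof.
rewrite big_cat /= prod_hit_factor; congr (_ * _)%N.
have -> : #|S| = size (positions 1 (bits_of_set S)) by rewrite -ranks_positions size_map cardE.
rewrite big_map positions_nat size_bits_of_set; set a := fun i => nth _ _ _.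
rewrite size_filter -sum1_count expn_sum [RHS]big_mkcond /=.
rewrite big_seq [RHS]big_seq; apply: eq_bigr => k kn.
rewrite /hit_factor /= positions_nat size_bits_of_set (_ : has _ _ = a k); first by case: (a k).
apply/hasP/idP => [[l]|ak]; first by rewrite mem_filter -eqn_leq => /andP[al _] /eqP ->.
by exists k; rewrite /= ?leqnn // mem_filter; apply/andP.
Qed.

(** A rate valid for all exponents at once; it serves both for the limit defining the flag vector
    and for the approximation of a ray by Eulerian posets. *)
Lemma ratio_bound (R : realType) (N h m : nat) : (0 < N)%N -> (h <= m)%N ->
  `|(N ^ h)%:R / N%:R ^+ m - (h == m)%:R| <= N%:R^-1 :> R.
Proof.
move=> N0 hm; have N1 : 1 <= N%:R :> R by rewrite ler1n.
have NR : 0 < N%:R :> R by rewrite ltr0n.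
case: eqP => [->|/eqP ne].
  by rewrite natrX divff ?subrr ?normr0 ?invr_ge0 ?ler0n // expf_neq0 // gt_eqF.
have {hm ne} lt : (h < m)%N by rewrite ltn_neqAle ne.
rewrite subr0 -(subnKC lt) exprD exprSr natrX !invfM !mulrA divff ?expf_neq0 ?gt_eqF // mul1r.
rewrite ger0_norm ?mulr_ge0 ?invr_ge0 ?exprn_ge0 ?ler0n //.
rewrite ler_piMr ?invr_ge0 ?ler0n // invf_le1 ?exprn_gt0 //.
exact: exprn_ege1.
Qed.

Lemma exists_inv_lt (R : realType) (e : R) : 0 < e -> exists N, forall k, (N <= k)%N -> k.+1%:R^-1 < e.
Proof.
move=> e0; exists (Num.bound e^-1) => k le.
rewrite invf_plt ?posrE ?ltr0n //; apply: lt_le_trans (archi_boundP _) _; first by rewrite invr_ge0 ltW.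
by rewrite ler_nat leqW.
Qed.

Lemma pre_limit_posetE n (II : {set 'I_n * 'I_n}) N :
  pre_limit_poset II N = iter_dup n [seq (p.1, p.2, N) | p <- pairs_of II].
Proof. by rewrite /pre_limit_poset /iter_dup /pairs_of !foldr_map. Qed.

Lemma pairs_of_ok n (II : {set 'I_n * 'I_n}) : all (itv_ok n) (pairs_of II).
Proof. by apply/allP => p /mapP[[a b] _ ->]; rewrite /itv_ok /= ltn_ord. Qed.

Lemma size_pairs_of n (II : {set 'I_n * 'I_n}) : size (pairs_of II) = #|II|.
Proof. by rewrite size_map cardE. Qed.

(** A chain of rank set $S$ has $N$ choices for each interval that $S$ meets; after division by
    $N^{|\mathcal I|}$ only the sets meeting every interval survive. *)
Lemma limit_flagE (R : realType) n (II : {set 'I_n * 'I_n}) (S : {set 'I_n}) :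
  limit_flag R II S = (hits (pairs_of II) (bits_of_set S) == #|II|)%:R.
Proof.
have flagE N : (flag_number (@rk (pre_limit_poset II N)) S)%:R =
    (N ^ hits (pairs_of II) (bits_of_set S))%:R :> R.
  rewrite pre_limit_posetE -prod_hit_factor.
  have ok : all (fun p => (0 < p.1.1)%N && (p.1.2 <= n)%N) [seq (p.1, p.2, N) | p <- pairs_of II].
    rewrite all_map; exact: pairs_of_ok.
  have [x [y [[xmin ymax rx ry] cs _]]] := iter_dupP R ok.
  rewrite -cs ?size_bits_of_set //.
  by apply: flag_number_chain_sum => // u v; apply: rk_homo.
have le : (hits (pairs_of II) (bits_of_set S) <= #|II|)%N.
  by rewrite -size_pairs_of count_size.
apply/cvg_lim => //; apply/cvgrPdist_lt => e e0.
have [N0 HN] := exists_inv_lt e0; exists N0.+1 => // -[//|N] /= lN.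
by rewrite distrC flagE (le_lt_trans (ratio_bound R _ le)) // HN.
Qed.

Lemma doubled_limit_in_cone (R : realType) n (II : {set 'I_n * 'I_n}) :
  balanced n (pairs_of II) -> @eulerian_cone R n (doubled_limit_flag_vector R II).
Proof.
move=> bal B /nbhs_ballP[e /= e0 eB].
(* Coordinate $S$ of the scaled flag vector is off by at most $2^{|S|}/N\le 2^n/N$, hence this
   tolerance. *)
have e1 : 0 < e / 2 ^+ n by rewrite divr_gt0 ?exprn_gt0.
have [N0 /(_ N0 (leqnn _)) HN] := exists_inv_lt e1.
have [eul flagE] := doubled_poset_eulerian R (ltn0Sn N0) (pairs_of_ok II) bal.
set v := flag_vector R n _ in eul.
exists ((N0.+1%:R ^+ #|II|)^-1 *: v); split.
  exists 1%N, (fun=> (N0.+1%:R ^+ #|II|)^-1), (fun=> v); split=> //; last by rewrite big_ord1.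
apply: eB; split=> // i j; rewrite (ord1 i) /ball /= !mxE flagE prod_doubled_hit_factor limit_flagE.
set S := enum_val j; set h := hits _ _.
rewrite natrM [_^-1 * _]mulrC natrX -mulrA -mulrBr normrM ger0_norm ?exprn_ge0 //.
have le : (h <= #|II|)%N by rewrite -size_pairs_of count_size.
have := le_lt_trans (ratio_bound R (ltn0Sn N0) le) HN.
rewrite distrC ltr_pdivlMr ?exprn_gt0 //; apply: le_lt_trans.
rewrite [X in _ <= X]mulrC ler_wpM2r // ler_eXn2l ?ltr1n //.
by rewrite -[X in (_ <= X)%N]card_ord max_card.
Qed.

(** * Polyhedral cones *)

Section ConicHull.
Variables (R : realType) (N m : nat) (v : 'I_m -> 'rV[R]_N).

Lemma conic_hull_range x : conic_hull (range v) x <->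
  exists2 c : 'I_m -> R, forall j, 0 <= c j & x = \sum_j c j *: v j.
Proof.
split=> [[k [c [y [c0 yv ->]]]]|[c c0 ->]]; last first.
  by exists m, c, v; split=> // j; exists j.
have {yv} /choice[f fP] : forall i, exists j, y i = v j by move=> i; have [j _ <-] := yv i; exists j.
exists (fun j => \sum_(i | f i == j) c i) => [j|]; first exact: sumr_ge0.
rewrite (partition_big f xpredT) //=; apply: eq_bigr => j _.
by rewrite scaler_suml; apply: eq_bigr => i /eqP <-; rewrite fP.
Qed.

Lemma conic_hullD x y : conic_hull (range v) x -> conic_hull (range v) y ->
  conic_hull (range v) (x + y).
Proof.
move=> /conic_hull_range[c c0 ->] /conic_hull_range[e e0 ->].
apply/conic_hull_range; exists (fun j => c j + e j) => [j|]; first exact: addr_ge0.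
by rewrite -big_split; apply: eq_bigr => j _; rewrite scalerDl.
Qed.

Lemma conic_hullZ a j : 0 <= a -> conic_hull (range v) (a *: v j).
Proof.
move=> a0; apply/conic_hull_range; exists (fun k => a *+ (k == j)) => [k|].
  by rewrite mulrn_wge0.
rewrite (bigD1 j) //= eqxx big1 ?addr0 // => k /negbTE ->.
by rewrite mulr0n scale0r.
Qed.

Lemma conic_hull_gen j : conic_hull (range v) (v j).
Proof. by rewrite -[v j]scale1r; apply: conic_hullZ. Qed.

End ConicHull.

Section Polyhedral.
Variables (R : realType) (N m : nat) (v : 'I_m -> 'rV[R]_N) (l : 'I_m -> {scalar 'rV[R]_N}).
Variables (C U : set 'rV[R]_N).
Hypothesis C_gen : C = conic_hull (range v).
Hypothesis C_ineq : forall x, C x <-> U x /\ forall i, 0 <= l i x.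
Hypothesis U_lin : forall a x y, U x -> U y -> U (x + a *: y).
Hypothesis l_pos : forall j, exists i, 0 < l i (v j).
Hypothesis ray_sep : forall j k, j != k -> exists i, l i (v j) = 0 /\ 0 < l i (v k).
Hypothesis facet_sep : forall i k, i != k -> exists j, l i (v j) = 0 /\ 0 < l k (v j).
Definition tight i := [seq v j | j <- enum 'I_m & l i (v j) == 0].
Hypothesis facet_span : forall i, exists2 j, 0 < l i (v j) &
  forall k, v k \in (<<tight i>> + <[v j]>)%VS.

Let Cv j : C (v j). Proof. by rewrite C_gen; apply: conic_hull_gen. Qed.
Let l_ge0 i j : 0 <= l i (v j). Proof. by have /C_ineq[] := Cv j. Qed.
Let v_neq0 j : v j != 0.
Proof. by have [i] := l_pos j; apply: contraTneq => ->; rewrite linear0 ltxx. Qed.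

Let ray_self (x : 'rV[R]_N) : ray x x. Proof. by exists 1; rewrite ?scale1r. Qed.

Let ray_eq (x y : 'rV[R]_N) t : 0 < t -> x = t *: y -> ray x = ray y.
Proof.
move=> t0 ->; apply/seteqP; split=> z [s s0 ->].
  by exists (s * t); rewrite ?mulr_ge0 ?(ltW t0) // scalerA.
exists (s / t); first by rewrite divr_ge0 // ltW.
by rewrite scalerA divfK // gt_eqF.
Qed.

Lemma polyhedral_extreme_rayP r : extreme_ray C r <-> exists j, r = ray (v j).
Proof.
split=> [[x [x0 Cx -> ext]]|[j ->]].
  have /conic_hull_range[c c0 xE] : conic_hull (range v) x by rewrite -C_gen.
  have [j cj] : exists j, c j != 0.
    apply: contrapT => H; move: x0; rewrite xE big1 ?eqxx // => j _.
    apply/eqP; rewrite scaler_eq0; apply/orP; left; apply: contrapT => cj.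
    by apply: H; exists j; apply/negP.
  (* One generator with nonzero coefficient is split off; extremality puts it on the ray of $x$. *)
  have [|||[t t0 tE] _] := ext (c j *: v j) (\sum_(k | k != j) c k *: v k).
  - by rewrite C_gen; apply: conic_hullZ.
  - rewrite C_gen; apply/conic_hull_range.
    exists (fun k => if k == j then 0 else c k) => [k|]; first by case: ifP.
    rewrite [RHS](bigD1 j) //= eqxx scale0r add0r.
    by apply: eq_bigr => k /negbTE ->.
  - have <- : x = c j *: v j + \sum_(k | k != j) c k *: v k by rewrite {1}xE (bigD1 j).
    exact: ray_self.
  exists j; have cj0 : 0 < c j by rewrite lt_neqAle eq_sym cj c0.
  have t1 : 0 < t.
    rewrite lt_neqAle t0 andbT eq_sym; apply/eqP => tz; move/eqP: tE.
    by rewrite tz scale0r scaler_eq0 (negbTE cj) (negbTE (v_neq0 j)).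
  apply: (@ray_eq _ _ (t^-1 * c j)); first by rewrite mulr_gt0 ?invr_gt0.
  by rewrite -scalerA tE scalerA mulVf ?scale1r // gt_eqF.
exists (v j); split=> // x y Cx Cy [t t0 xyE].
(* For $k\ne j$ some form vanishes at $v_j$ and is positive at $v_k$. Being nonnegative on $z$ and
   $w$ with sum zero, it vanishes on $z$, so $v_k$ cannot occur in $z$. *)
suff key z w : C z -> C w -> z + w = t *: v j -> ray (v j) z.
  by split; [exact: key xyE | apply: (key y x) => //; rewrite addrC].
move=> Cz Cw zwE; have /conic_hull_range[c c0 zE] : conic_hull (range v) z by rewrite -C_gen.
exists (c j) => //; rewrite zE (bigD1 j) //= big1 ?addr0 // => k kj.
move: kj; rewrite eq_sym => /ray_sep[i [lj lk]].
have lz : l i z = 0.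
  have := congr1 (l i) zwE; rewrite linearD linearZ /= lj mulr0 => /eqP.
  rewrite paddr_eq0; first by case/andP => /eqP.
  - by have /C_ineq[] := Cz.
  - by have /C_ineq[] := Cw.
have : \sum_k c k * l i (v k) = 0.
  by rewrite -[RHS]lz zE linear_sum; apply: eq_bigr => ? _; rewrite linearZ.
move=> /eqP; rewrite psumr_eq0 => [/allP/(_ k)|? _]; last by rewrite mulr_ge0.
rewrite mem_index_enum => /(_ isT); rewrite mulf_eq0 (gt_eqF lk) orbF => /eqP ->.
by rewrite scale0r.
Qed.

Lemma polyhedral_ray_inj : injective (fun j => ray (v j)).
Proof.
move=> j k E; apply: contrapT => /eqP jk; have [i [lj lk]] := ray_sep jk.
have [t _ vE] : ray (v j) (v k) by rewrite E; apply: ray_self.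
by move: lk; rewrite vE linearZ /= lj mulr0 ltxx.
Qed.

Definition face i : set 'rV[R]_N := C `&` [set x | l i x = 0].

Lemma cone_dim_unique (A : set 'rV[R]_N) k k' : cone_dim A k -> cone_dim A k' -> k = k'.
Proof.
move=> [W [W1 W2 <-]] [W' [W1' W2' <-]]; apply/eqP; rewrite eqn_leq.
by rewrite !dimvS ?W2 ?W2'.
Qed.

Let faceP i x : face i x -> x \in <<tight i>>%VS.
Proof.
move=> [Cx lx]; have /conic_hull_range[c c0 xE] : conic_hull (range v) x by rewrite -C_gen.
have : \sum_k c k * l i (v k) = 0.
  by rewrite -[RHS]lx xE linear_sum; apply: eq_bigr => ? _; rewrite linearZ.
move=> /eqP; rewrite psumr_eq0 => [/allP H|? _]; last by rewrite mulr_ge0.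
rewrite xE rpred_sum // => k _.
have := H k (mem_index_enum _); rewrite mulf_eq0 => /orP[/eqP ->|lk]; first by rewrite scale0r rpred0.
by apply/rpredZ/memv_span/map_f; rewrite mem_filter lk mem_enum.
Qed.

Lemma face_dim i : cone_dim (face i) (\dim <<tight i>>).
Proof.
exists <<tight i>>%VS; split=> // [x|W HW]; first exact: faceP.
by apply/span_subvP => x /mapP[j]; rewrite mem_filter => /andP[/eqP lj _] ->; apply: HW.
Qed.

(** The tight generators span a subspace of the hyperplane $l_i=0$, and a single generator off the
    hyperplane completes it to the span of the cone. *)
Lemma polyhedral_dim i : cone_dim C (\dim <<tight i>>).+1.
Proof.
have [j lj span] := facet_span i.
exists (<<tight i>> + <[v j]>)%VS; split=> [x Cx|W HW|].
- have /conic_hull_range[c c0 ->] : conic_hull (range v) x by rewrite -C_gen.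
  by apply: rpred_sum => k _; apply: rpredZ.
- rewrite subv_add -memvE HW // andbT.
  by apply/span_subvP => x /mapP[k _ ->]; apply: HW.
rewrite dimv_disjoint_sum ?dim_vline ?v_neq0 ?addn1 //.
apply/eqP; rewrite -subv0; apply/subvP => x; rewrite memv_cap => /andP[xt /vlineP[a xE]].
have lx : l i x = 0.
  have : (<<tight i>> <= lker (linfun (l i : 'rV[R]_N -> R^o)))%VS.
    by apply/span_subvP => y /mapP[k]; rewrite mem_filter memv_ker lfunE /= => /andP[lk _] ->.
  by move=> /subvP/(_ _ xt); rewrite memv_ker lfunE /= => /eqP.
move: lx; rewrite xE linearZ /= => /eqP; rewrite mulf_eq0 (gt_eqF lj) orbF => /eqP ->.
by rewrite scale0r mem0v.
Qed.

Lemma polyhedral_determines_facet i : determines_facet C (l i) (face i).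
Proof.
split=> // [x /C_ineq[] //|]; exists (\dim <<tight i>>).
by split; [exact: polyhedral_dim | exact: face_dim].
Qed.

(** A facet contained in no [face i] would contain, by summing suitable points, a point where all
    forms are positive. Such a point can be moved slightly against every generator, so the facet
    would be the whole cone. Inside a [face i], equal dimensions give equal spans and hence
    equality. *)
Lemma polyhedral_facetP F : facet C F <-> exists i, F = face i.
Proof.
split=> [[f [f_ge0 FE [k [dC dF]]]]|[i ->]]; last by exists (l i); exact: polyhedral_determines_facet.
have [i FS] : exists i, forall x, F x -> l i x = 0.
  apply: contrapT => noi.
  have {noi} /choice[y yP] : forall i, exists x, F x /\ 0 < l i x.
    move=> i; apply: contrapT => H; apply: noi; exists i => x Fx.
    have Cx : C x by move: Fx; rewrite FE => -[].
    have := (C_ineq x).1 Cx => -[_ /(_ i)]; rewrite le_eqVlt => /predU1P[->//|lx].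
    by case: H; exists x.
  have CD : forall x z, C x -> C z -> C (x + z) by rewrite C_gen; exact: conic_hullD.
  pose z := \sum_i y i.
  have Cy i : C (y i) by have [] := yP i; rewrite FE => -[].
  have C0 : C 0.
    rewrite C_gen; apply/conic_hull_range; exists (fun=> 0) => //.
    by rewrite big1 // => ? _; rewrite scale0r.
  have Cz : C z by apply: (big_ind C) => // i _; apply: Cy.
  have fz : f z = 0.
    by rewrite linear_sum big1 // => i _; have [] := yP i; rewrite FE => -[].
  have lz i : 0 < l i z.
    rewrite linear_sum (bigD1 i) //= ltr_pwDl //; first by have [] := yP i.
    by apply: sumr_ge0 => j _; have /C_ineq[_] := Cy j.
  have fv j : f (v j) = 0.
    (* The 1 in the denominators covers the case $l_i(v_j)=0$. With this $e$ the point $z-e\,v_j$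
       still lies in the cone, and $f(z)=0$ then forces $f(v_j)\le0$. *)
    pose e := \big[Num.min/1]_i (l i z / (1 + l i (v j))).
    have p1 i : 0 < 1 + l i (v j) by rewrite ltr_pwDl.
    have e0 : 0 < e by apply: lt_bigmin => // i _; rewrite divr_gt0.
    have Cze : C (z + (- e) *: v j).
      apply/C_ineq; split; first by apply: U_lin; [have /C_ineq[] := Cz | have /C_ineq[] := Cv j].
      move=> i; rewrite linearD linearZ /= mulNr subr_ge0.
      apply: (@le_trans _ _ (e * (1 + l i (v j)))); first by rewrite ler_wpM2l ?lerDr // ltW.
      by rewrite -ler_pdivlMr //; exact: bigmin_le_cond.
    apply/eqP; rewrite eq_le f_ge0 // andbT.
    have := f_ge0 _ Cze; rewrite linearD linearZ /= fz add0r mulNr oppr_ge0.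
    by rewrite pmulr_rle0.
  have FC : F = C.
    rewrite FE; apply/seteqP; split=> [x []//|x Cx]; split=> //=.
    have /conic_hull_range[c c0 ->] : conic_hull (range v) x by rewrite -C_gen.
    by rewrite linear_sum big1 // => j _; rewrite linearZ /= fv mulr0.
  by move: dF; rewrite FC => /(cone_dim_unique dC) /eqP; rewrite eqn_leq ltnn.
exists i.
have dk : \dim <<tight i>> = k.
  by apply/eq_add_S; apply: cone_dim_unique (polyhedral_dim i) dC.
have [W [FW Wmin Wk]] := dF.
have WE : W = <<tight i>>%VS.
  apply/eqP; rewrite eqEdim dk Wk leqnn andbT Wmin // => x Fx; apply: faceP; split; last exact: FS.
  by move: Fx; rewrite FE => -[].
apply/seteqP; split=> x; first by move=> Fx; split; [by move: Fx; rewrite FE => -[] | exact: FS].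
move=> fx; rewrite FE; split; first by case: fx.
have : (W <= lker (linfun (f : 'rV[R]_N -> R^o)))%VS.
  by apply: Wmin => y; rewrite FE memv_ker lfunE /= => -[_ ->].
rewrite WE => /subvP/(_ x (faceP fx)); by rewrite memv_ker lfunE /= => /eqP.
Qed.

Lemma polyhedral_face_inj : injective face.
Proof.
move=> i k E; apply: contrapT => /eqP ik; have [j [lj lk]] := facet_sep ik.
have [_ /=] : face k (v j) by rewrite -E.
by move=> lk0; rewrite lk0 ltxx in lk.
Qed.

Lemma card_range_ord (T : Type) (f : 'I_m -> T) : injective f -> (range f #= `I_m)%card.
Proof.
by move=> fI; apply: card_eq_trans (inj_card_eq _) _; [move=> ? ? _ _; exact: fI | rewrite card_eq_sym; exact: card_II].
Qed.

End Polyhedral.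

(** * Values of the forms on the rays *)

(** The value of $L_S$ on a ray: the factor $2^{|T|}$ of the doubling turns $(-1/2)^{|T|}$ into a
    sign, so the value is an integer. *)
Definition ray_value (J : seq (nat * nat)) (b : bitseq) : int :=
  foldr (fun t s => if hits J t == size J
                    then (if odd (count negb b + count id t) then s - 1 else s + 1) else s)
    0 (bits_between (map negb b) (nseq (size b) true)).

Definition form_value (J : seq (nat * nat)) (m v : bitseq) : int :=
  let s := foldr (fun b s => ray_value J b + s) 0 (bits_between m v) in
  if odd (count id m)./2 then - s else s.

Lemma flagL_doubled_limit (R : realType) n (II : {set 'I_n * 'I_n}) J b :
  perm_eq (pairs_of II) J -> size b = n ->
  flagL (set_of_bits n b) (doubled_limit_flag_vector R II) = (ray_value J b)%:~R.
Proof.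
move=> pJ sb; rewrite flagL_bits // /ray_value sb prod_sparse_sign.
have -> : (size b - count id b = count negb b)%N by rewrite -(count_predC id b) addKn.
set c := count negb b.
have st t : t \in bits_between (map negb b) (nseq n true) -> size t = n.
  by move/size_mem_bits_between; rewrite size_map size_nseq sb implb_nseq_true ?size_map //; apply.
elim: (bits_between _ _) st => [|t s IH] st; first by rewrite big_nil mulr0.
rewrite big_cons mulrDr IH => [|u us]; last by apply: st; rewrite inE us orbT.
have szt : size t = n by apply: st; rewrite mem_head.
rewrite flag_coord_mk limit_flagE set_of_bitsK // card_set_of_bits // prod_half_sign.
have -> : hits (pairs_of II) t = hits J t by apply/seq.permP.
rewrite -size_pairs_of (perm_size pJ) [X in _ * X + _]mulrA -exprMn mulNr mulVf ?pnatr_eq0 //.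
rewrite mulrA -exprD -signr_odd /=; case: eqP => _ /=; last by rewrite mulr0 add0r.
by case: (odd _); rewrite /= mulr1 ?intrD ?rmorphB /= addrC.
Qed.

Lemma facet_form_doubled_limit (R : realType) n (II : {set 'I_n * 'I_n}) J m v :
  perm_eq (pairs_of II) J -> size m = n -> size v = n -> all2 implb m v ->
  facet_form m v (doubled_limit_flag_vector R II) = (form_value J m v)%:~R.
Proof.
move=> pJ sm sv mv; rewrite /facet_form sum_set_bits // card_set_of_bits // /form_value.
rewrite -signr_odd; have -> (s : int) : (if odd (count id m)./2 then - s else s) =
  (-1) ^+ odd (count id m)./2 * s by case: odd; rewrite ?expr1 ?expr0 ?mulN1r ?mul1r.
rewrite intrM rmorph_sign; congr (_ * _).
have st b : b \in bits_between m v -> size b = n.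
  by move/size_mem_bits_between => ->; rewrite ?sm ?sv.
elim: (bits_between _ _) st => [|b s IH] st; first by rewrite big_nil.
rewrite big_cons /= intrD (flagL_doubled_limit _ pJ) ?st ?mem_head // IH // => u us.
by apply: st; rewrite inE us orbT.
Qed.

Definition set_of_pairs n (J : seq (nat * nat)) : {set 'I_n * 'I_n} :=
  [set p : 'I_n * 'I_n | ((nat_of_ord p.1).+1, (nat_of_ord p.2).+1) \in J]%SET.

(** Truncated subtraction returns 0 for disjoint intervals. *)
Definition meet_size (p q : nat * nat) : nat := ((minn p.2 q.2).+1 - maxn p.1 q.1)%N.

Definition even_pairs n (J : seq (nat * nat)) : bool :=
  [&& uniq J,
      all (fun p => [&& 0 < p.1, p.1 <= p.2 & p.2 <= n]%N) J,
      all (fun p => all (fun q => ((q.1 <= p.1) && (p.2 <= q.2) ==> (p == q))%N) J) J &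
      all (fun p => all (fun q => ~~ odd (meet_size p q)) J) J].

Lemma perm_pairs_of n J : even_pairs n J -> perm_eq (pairs_of (set_of_pairs n J)) J.
Proof.
move=> /and4P[uJ /allP okJ _ _]; apply: uniq_perm => //.
  by rewrite map_inj_uniq ?enum_uniq // => -[a b] [c d] /= [/val_inj -> /val_inj ->].
move=> [a b]; apply/mapP/idP => [[[i j]]|pJ].
  by rewrite mem_enum inE => ? ->.
have /and3P[/= a0 ab bn] := okJ _ pJ.
have lt k : (0 < k <= n -> k.-1 < n)%N by case: k.
have la := lt a ltac:(by rewrite a0 (leq_trans ab)).
have lb := lt b ltac:(by rewrite (leq_trans a0 ab)).
have b0 := leq_trans a0 ab.
by exists (Ordinal la, Ordinal lb); rewrite ?mem_enum ?inE /= !prednK.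
Qed.

Lemma card_ord_interval n (a b : nat) : (b < n)%N ->
  #|[set k : 'I_n | (a <= k <= b)%N]%SET| = (b.+1 - a)%N.
Proof.
move=> bn; rewrite cardsE cardE size_filter.
rewrite (eq_count (a2 := preim val (fun k => a <= k <= b)%N)) // -count_map -enumT val_enum_ord.
have -> : n = (b.+1 + (n - b.+1))%N by rewrite subnKC.
rewrite iotaD count_cat [X in (_ + X)%N](_ : _ = 0%N); last first.
  apply/eqP; rewrite -leqn0 leqNgt -has_count; apply/hasPn => k; rewrite mem_iota add0n => /andP[bk _] /=.
  by rewrite [(k <= b)%N]leqNgt bk andbF.
rewrite addn0; have [ab|ba] := leqP a b.+1; last first.
  rewrite (eqP (_ : b.+1 - a == 0)%N) ?subn_eq0 ?(ltnW ba) //.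
  apply/eqP; rewrite -leqn0 leqNgt -has_count; apply/hasPn => k; rewrite mem_iota add0n => /andP[_ kb] /=.
  by apply/negP => /andP[ak _]; have := leq_trans ba (leq_trans ak (ltnW kb)); rewrite ltnn.
rewrite -{1}(subnKC ab) iotaD count_cat add0n [X in (X + _)%N](_ : _ = 0%N) ?add0n; last first.
  apply/eqP; rewrite -leqn0 leqNgt -has_count; apply/hasPn => k; rewrite mem_iota add0n => /andP[_ ka] /=.
  by rewrite leqNgt ka.
rewrite (eq_in_count (a2 := xpredT)) ?count_predT ?size_iota // => k.
by rewrite mem_iota subnKC // ltnS => ->.
Qed.

Lemma even_interval_system_of_pairs n J : even_pairs n J ->
  even_interval_system (set_of_pairs n J).
Proof.
move=> /and4P[_ /allP okJ /allP cJ /allP eJ].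
have le p : p \in set_of_pairs n J -> (p.1 <= p.2)%N.
  by rewrite inE => /okJ /and3P[].
split; first split=> // [p q pI qI sub].
  have /fintype.subsetP sub' := sub.
  have := sub' p.1; have := sub' p.2; rewrite !inE !leqnn le // => /(_ isT)/andP[_ h2] /(_ isT)/andP[h1 _].
  have := pI; rewrite inE => /cJ /allP; have := qI; rewrite inE => qJ /(_ _ qJ) /=.
  rewrite !ltnS h1 h2 /= => /eqP[e1 e2].
  by case: p q e1 e2 {pI qI sub sub' h1 h2 qJ} => [a b] [c d] /= /val_inj -> /val_inj ->.
move=> p q; rewrite !inE => pJ qJ; have /allP/(_ _ qJ) := eJ _ pJ; rewrite /meet_size /=.
have -> : itv_set p :&: itv_set q = [set k : 'I_n | (maxn p.1 q.1 <= k <= minn p.2 q.2)%N]%SET.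
  by apply/setP => k; rewrite !inE geq_max leq_min andbACA.
by rewrite card_ord_interval ?gtn_min ?ltn_ord // minnSS maxnSS subSS.
Qed.

(** * Admissible pairs *)

Definition in_bits (b : bitseq) (k : nat) : bool := (0 < k)%N && nth false b k.-1.

Lemma mem_ranks_bits n b k : size b = n -> (k \in ranks (set_of_bits n b)) = in_bits b k.
Proof.
move=> sb; apply/mapP/idP => [[i]|/andP[k0 bk]].
  by rewrite mem_enum inE => bi ->.
have kn : (k.-1 < n)%N by rewrite -sb ltnNge; apply/negP => /(nth_default false) E; rewrite E in bk.
by exists (Ordinal kn); rewrite ?mem_enum ?inE /= ?prednK.
Qed.

Lemma in_bits_le b k : in_bits b k -> (k <= size b)%N.
Proof.
case: k => // k /andP[_ bk]; rewrite ltnNge; apply/negP => /(nth_default false) E.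
by rewrite /= E in bk.
Qed.

Definition max_intervalb (A : pred nat) (a b : nat) : bool :=
  [&& (a <= b)%N, A b, all A (iota a (b.+1 - a)), ~~ A b.+1 & (a == 0%N) || ~~ A a.-1].

(** This direction suffices, because maximal intervals occur in [admissible] only as hypotheses. *)
Lemma max_interval_bool (A A' : pred nat) a b : A =1 A' -> max_interval A a b -> max_intervalb A' a b.
Proof.
move=> AA' [ab inA maxA]; apply/and5P; split=> //.
- by rewrite -AA' inA // ab leqnn.
- apply/allP => k; rewrite mem_iota subnKC; last exact: leqW.
  rewrite ltnS => kk; by rewrite -AA' inA.
- apply/negP; rewrite -AA' => Ab1.
  have [||k|_ /eqP] := maxA a b.+1 => //; last by rewrite eqn_leq ltnn.
  by rewrite [(k <= b.+1)%N]leq_eqVlt => /andP[ak /predU1P[->//|kb]]; apply: inA; rewrite ak.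
case: a ab inA maxA => //= a ab inA maxA; apply/negP; rewrite -AA' => Aa.
have [||k|/eqP] := maxA a b => //; last by rewrite eqn_leq ltnn andbF.
by rewrite [(a <= k)%N]leq_eqVlt => /andP[/predU1P[<-//|ak] kb]; apply: inA; rewrite ak.
Qed.

Definition end_condition n (m : bitseq) (a b : nat) : bool :=
  let R := iota 0 n.+3 in
  let inM k := in_bits m k && (a <= k <= b)%N in
  [&& [|| all (fun k => inM k == false) R,
          all (fun k => inM k == (a <= k <= a.+1)%N) R |
          all (fun k => inM k == (b.-1 <= k <= b)%N) R],
      [|| in_bits m a, a == 1%N | (2 <= a)%N && in_bits m (a - 2)] &
      [|| in_bits m b, b + 2 == n + 2 | in_bits m (b + 2)]]%N.

Definition admissibleb n (m v : bitseq) : bool :=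
  all (fun a => all (fun b =>
    [&& max_intervalb (in_bits v) a b ==> (2 <= b.+1 - a)%N && end_condition n m a b &
        max_intervalb (fun k => (k <= n.+1)%N && ~~ in_bits v k) a b ==> (b.+1 - a <= 3)%N])
  (iota 0 n.+2)) (iota 0 n.+2).

Lemma admissible_bool n m v : size m = n -> size v = n -> all2 implb m v ->
  admissibleb n m v -> admissible (set_of_bits n m) (set_of_bits n v).
Proof.
move=> sm sv mv adm.
have inV : mem (ranks (set_of_bits n v)) =1 in_bits v by move=> k; apply: mem_ranks_bits.
have bnd k : in_bits v k -> (k < n.+2)%N by move/in_bits_le; rewrite sv => /leqW.
have both a b : (a < n.+2)%N -> (b < n.+2)%N ->
    (max_intervalb (in_bits v) a b ==> (2 <= b.+1 - a)%N && end_condition n m a b) /\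
    (max_intervalb (fun k => (k <= n.+1)%N && ~~ in_bits v k) a b ==> (b.+1 - a <= 3)%N).
  move=> an bn; move/allP: adm => /(_ a); rewrite mem_iota => /(_ an)/allP/(_ b).
  by rewrite mem_iota => /(_ bn)/andP.
have V a b : max_interval (mem (ranks (set_of_bits n v))) a b ->
    (2 <= b.+1 - a)%N /\ end_condition n m a b.
  move=> /(max_interval_bool inV) H; have /and5P[ab Ab _ _ _] := H.
  have bn := bnd _ Ab; by have [] := both a b (leq_ltn_trans ab bn) bn; rewrite H => /andP.
split.
- by rewrite subset_bits.
- by move=> a b /V[].
- move=> a b H.
  have /max_interval_bool/(_ H) H' : [pred k | (k <= n.+1)%N && (k \notin ranks (set_of_bits n v))]
      =1 (fun k => (k <= n.+1)%N && ~~ in_bits v k).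
    by move=> k /=; rewrite mem_ranks_bits.
  have /and5P[ab /andP[bn _] _ _ _] := H'.
  by have [_] := both a b (leq_trans ab bn) bn; rewrite H'.
move=> a b /[dup] H /V[_ /and3P[c1 c2 c3]].
have /and5P[ab Ab _ _ _] := max_interval_bool inV H.
have bn : (b <= n)%N by rewrite -sv in_bits_le.
split; rewrite ?mem_ranks_bits //.
(* Since $b\le n$, none of the sets compared contains a number above $n+2$, so testing a finite
   range decides their equality. *)
- have ext (f : pred nat) : (forall k, (n.+3 <= k)%N -> f k = false) ->
      all (fun k => (in_bits m k && (a <= k <= b)%N) == f k) (iota 0 n.+3) ->
      [pred k | (k \in ranks (set_of_bits n m)) && (a <= k <= b)%N] =i f.
    move=> f0 /allP H' k; rewrite inE mem_ranks_bits // -topredE /=.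
    have [kn|nk] := ltnP k n.+3; first by apply/eqP/H'; rewrite mem_iota.
    rewrite f0 //; apply/negbTE/negP => /andP[/in_bits_le km _].
    by move: nk; rewrite ltnNge; case/negP; rewrite -sm leqW // leqW.
  case/or3P: c1 => c1; [apply: Or31 | apply: Or32 | apply: Or33]; apply: (ext _ _ c1) => k nk //=.
    by apply/negbTE/negP => /andP[_ ka]; lia.
  by apply/negbTE/negP => /andP[_ kb]; lia.
- move=> /negbTE ma; move: c2; rewrite ma /= => /orP[/eqP ->|/andP[a2 ma2]]; first by left.
  by right; exists (a - 2)%N; rewrite ?mem_ranks_bits // subnK.
- move=> /negbTE mb; move: c3; rewrite mb /= => /orP[/eqP ->|mb2]; first by left.
  by right.
Qed.

(** * Rays and facets in rank at most six *)

(* When two rays p and q lie off the facet, [facet_rel] is the pair (r, s) of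
   the linear relation v_p + v_r = v_q + v_s. *)
Record facet_datum := FacetDatum {
  facet_M : seq nat;
  facet_V : seq nat;
  facet_block : nat * nat;
  facet_blocks : seq (nat * nat);
  facet_off : seq nat;
  facet_rel : nat * nat }.

Definition tuple_of_facet f :=
  (facet_M f, facet_V f, facet_block f, facet_blocks f, facet_off f, facet_rel f).
Definition facet_of_tuple t :=
  let: (M, V, b, bs, off, r) := t in FacetDatum M V b bs off r.
Lemma tuple_of_facetK : cancel tuple_of_facet facet_of_tuple.
Proof. by case. Qed.
HB.instance Definition _ := Equality.copy facet_datum (can_type tuple_of_facetK).

(** For $n\le5$ these are all the even interval systems on $[1,n]$. *)
Definition rays (n : nat) : seq (seq (nat * nat)) :=
  match n with
  | 0 => [:: [::]]
  | 1 => [:: [::]]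
  | 2 => [:: [::]; [:: (1, 2)]]
  | 3 => [:: [::]; [:: (1, 2)]; [:: (2, 3)]]
  | 4 => [:: [::]; [:: (1, 2)]; [:: (1, 4)]; [:: (2, 3)]; [:: (3, 4)]; [:: (1, 2); (3, 4)]]
  | 5 => [:: [::]; [:: (1, 2)]; [:: (1, 4)]; [:: (2, 3)]; [:: (2, 5)]; [:: (3, 4)]; [:: (4, 5)]; [:: (1, 2); (3, 4)]; [:: (1, 2); (4, 5)]; [:: (2, 3); (4, 5)]]
  | _ => [::]
  end%N.

(** The order is made for [learn]: when a form is reached, at most one of its coordinates is still
    undetermined. *)
Definition facets (n : nat) : seq facet_datum :=
  match n with
  | 0 => [:: FacetDatum [::] [::] (0, 0) [::] [:: 0] (0, 0)]
  | 1 => [:: FacetDatum [::] [::] (0, 0) [:: (0, 0)] [:: 0] (0, 0)]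
  | 2 => [:: FacetDatum [:: 1; 2] [:: 1; 2] (1, 0) [::] [:: 1] (0, 0);
      FacetDatum [::] [:: 1; 2] (0, 2) [::] [:: 0] (0, 0)]
  | 3 => [:: FacetDatum [:: 1; 2] [:: 1; 2] (1, 0) [:: (0, 0)] [:: 1] (0, 0);
      FacetDatum [:: 2; 3] [:: 2; 3] (0, 0) [:: (1, 0)] [:: 2] (0, 0);
      FacetDatum [::] [:: 1; 2; 3] (0, 3) [::] [:: 0] (0, 0)]
  | 4 => [:: FacetDatum [:: 1; 2] [:: 1; 2] (1, 0) [:: (0, 0); (0, 0)] [:: 1; 5] (4, 2);
      FacetDatum [:: 2; 3] [:: 2; 3] (0, 0) [:: (1, 0); (0, 0)] [:: 3] (0, 0);
      FacetDatum [:: 3; 4] [:: 3; 4] (0, 0) [:: (0, 0); (1, 0)] [:: 4; 5] (1, 2);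
      FacetDatum [:: 3; 4] [:: 1; 2; 3; 4] (2, 2) [::] [:: 2; 4] (5, 1);
      FacetDatum [:: 1; 2] [:: 1; 2; 3; 4] (1, 2) [::] [:: 1; 2] (4, 5);
      FacetDatum [::] [:: 1; 2; 3; 4] (0, 4) [::] [:: 0] (0, 0)]
  | 5 => [:: FacetDatum [:: 2; 3] [:: 2; 3] (0, 0) [:: (1, 0); (0, 0); (0, 0)] [:: 3; 9] (6, 4);
      FacetDatum [:: 3; 4] [:: 3; 4] (0, 0) [:: (0, 0); (1, 0); (0, 0)] [:: 5; 7] (1, 2);
      FacetDatum [:: 1; 2; 4; 5] [:: 1; 2; 4; 5] (1, 0) [:: (1, 0)] [:: 8] (0, 0);
      FacetDatum [:: 3; 4] [:: 1; 2; 3; 4] (2, 2) [:: (0, 0)] [:: 2; 5] (7, 1);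
      FacetDatum [:: 4; 5] [:: 1; 2; 4; 5] (0, 2) [:: (1, 0)] [:: 6; 9] (3, 4);
      FacetDatum [:: 1; 2] [:: 1; 2; 4; 5] (1, 0) [:: (0, 2)] [:: 1; 7] (5, 2);
      FacetDatum [:: 2; 3] [:: 2; 3; 4; 5] (0, 0) [:: (1, 2)] [:: 3; 4] (6, 9);
      FacetDatum [:: 4; 5] [:: 1; 2; 3; 4; 5] (2, 3) [::] [:: 4; 6] (9, 3);
      FacetDatum [:: 1; 2] [:: 1; 2; 3; 4; 5] (1, 3) [::] [:: 1; 2] (5, 7);
      FacetDatum [::] [:: 1; 2; 3; 4; 5] (0, 5) [::] [:: 0] (0, 0)]
  | _ => [::]
  end%N.

(** Indices of facets with $F_i+F_j=F_k+F_l$ on vectors whose uneven coordinates vanish. Each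
    relation belongs to one cone over a square; for $n\le3$ the cone is simplicial. *)
Definition relations (n : nat) : seq ((nat * nat) * (nat * nat)) :=
  match n with
  | 0 => [::]
  | 1 => [::]
  | 2 => [::]
  | 3 => [::]
  | 4 => [:: ((0, 3), (2, 4))]
  | 5 => [:: ((5, 3), (1, 8)); ((0, 7), (4, 6))]
  | _ => [::]
  end%N.

Definition bits_of_list n (s : seq nat) : bitseq := [seq k \in s | k <- iota 1 n].
Local Notation facet_m n f := (bits_of_list n (facet_M f)).
Local Notation facet_v n f := (bits_of_list n (facet_V f)).
Definition empty_facet := FacetDatum [::] [::] (0, 0)%N [::] [::] (0, 0)%N.
Local Notation nth_ray n j := (nth [::] (rays n) j).
Local Notation nth_facet n i := (nth empty_facet (facets n) i).

Definition facet_ok n (f : facet_datum) : bool :=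
  let m := facet_m n f in let v := facet_v n f in
  [&& all2 implb m v, codes_between m v == blocks_codes (facet_block f) (facet_blocks f),
      odd (count id m)./2 == odd (signed_blocks (facet_block f :: facet_blocks f)),
      admissibleb n m v,
      uniq (facet_off f) && all (fun j => j < size (rays n))%N (facet_off f) &
      all (fun j => form_value (nth_ray n j) m v == (j \in facet_off f)%:R) (iota 0 (size (rays n)))].

Definition span_ok n (f : facet_datum) : bool :=
  match facet_off f with
  | [:: p] => true
  | [:: p; q] => let (r, s) := facet_rel f in
      [&& (r < size (rays n))%N, (s < size (rays n))%N,
          r \notin facet_off f, s \notin facet_off f &
          all (fun b => ray_value (nth_ray n p) b + ray_value (nth_ray n r) b ==
                        ray_value (nth_ray n q) b + ray_value (nth_ray n s) b) (all_bits n)]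
  | _ => false
  end.

Definition incidence_separates n : bool :=
  let R := iota 0 (size (rays n)) in
  let off i := facet_off (nth_facet n i) in
  [&& all (fun j => has (fun i => j \in off i) R) R,
      all (fun j => all (fun k => (j != k) ==> has (fun i => (j \notin off i) && (k \in off i)) R) R) R &
      all (fun i => all (fun k => (i != k) ==> has (fun j => (j \notin off i) && (j \in off k)) R) R) R].

(* If all the facet forms vanish, so does the coordinate L_b of the only bit
   string b of a form that is not yet known to give zero. *)
Definition learn n (known : seq bitseq) (f : facet_datum) : seq bitseq :=
  match [seq b <- bits_between (facet_m n f) (facet_v n f) | b \notin known] with
  | [:: b] => b :: known
  | _ => known
  end.

Definition uneven n : seq bitseq := [seq b <- all_bits n | ~~ even_runs false b].

Definition form_coef n (f : facet_datum) (b : bitseq) : int :=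
  if b \in bits_between (facet_m n f) (facet_v n f) then
    if odd (count id (facet_m n f))./2 then - 1 else 1
  else 0.

Definition relation_ok n (r : (nat * nat) * (nat * nat)) : bool :=
  let F i b := form_coef n (nth_facet n i) b in
  [&& r.1.1 < size (facets n), r.1.2 < size (facets n), r.2.1 < size (facets n) &
      r.2.2 < size (facets n)]%N && all (fun b => even_runs false b ==>
    (F r.1.1 b + F r.1.2 b == F r.2.1 b + F r.2.2 b)) (all_bits n).

Definition data_ok n : bool :=
  [&& size (rays n) == 'C(n, n./2), size (facets n) == 'C(n, n./2),
      all (even_pairs n) (rays n) & all (balanced n) (rays n)] &&
  [&& all (facet_ok n) (facets n), all (span_ok n) (facets n), incidence_separates n,
      all (fun b => b \in foldl (learn n) (uneven n) (facets n)) (all_bits n) &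
      all (relation_ok n) (relations n)].

Lemma data_okP n : (n <= 5)%N -> data_ok n.
Proof. by case: n => [|[|[|[|[|[|n]]]]]] // _; vm_compute. Qed.

(** In a cone over a square each facet misses two adjacent rays. The solutions form a one-parameter
    family; nonnegativity is reached by letting $a$ or $c$ vanish. *)
Lemma square_split (R : realType) (y1 y2 y3 y4 : R) :
  0 <= y1 -> 0 <= y2 -> 0 <= y3 -> 0 <= y4 -> y1 + y3 = y2 + y4 ->
  exists a b c d, [/\ [/\ 0 <= a, 0 <= b, 0 <= c & 0 <= d],
    a + b = y1, b + c = y2, c + d = y3 & a + d = y4].
Proof.
move=> y10 y20 y30 y40 E; have [le|le] := leP y1 y2.
  by exists 0, y1, (y2 - y1), y4; do ?split; lra.
by exists (y1 - y2), y2, 0, y3; do ?split; lra.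
Qed.

(** The equations say that $\sum_j c_jv_j$ takes the prescribed values under the forms. A facet
    missing one ray gives its coefficient directly; the others form one square for $n=4$ and two for
    $n=5$. *)
Lemma facet_solvable (R : realType) n (L : nat -> R) : (n <= 5)%N ->
  (forall i, (i < size (facets n))%N -> 0 <= L i) ->
  (forall r, r \in relations n -> L r.1.1 + L r.1.2 = L r.2.1 + L r.2.2) ->
  exists c : nat -> R, (forall j, (j < size (facets n))%N -> 0 <= c j) /\
    forall i, (i < size (facets n))%N -> \sum_(j <- facet_off (nth_facet n i)) c j = L i.
Proof.
case: n => [|[|[|[|[|[|n]]]]]] // _ L0 rel.
- exists (nth 0 [:: L 0%N]); split; first by case=> [|j] // _ /=; rewrite L0.
  by case=> [|i] // _; rewrite /= big_seq1.
- exists (nth 0 [:: L 0%N]); split; first by case=> [|j] // _ /=; rewrite L0.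
  by case=> [|i] // _; rewrite /= big_seq1.
- exists (nth 0 [:: L 1%N; L 0%N]); split; first by case=> [|[|j]] // _ /=; rewrite ?L0.
  by case=> [|[|i]] // _; rewrite /= big_seq1.
- exists (nth 0 [:: L 2; L 0%N; L 1%N]); split; first by case=> [|[|[|j]]] // _ /=; rewrite ?L0.
  by case=> [|[|[|i]]] // _; rewrite /= big_seq1.
- have [a [b [c [d [[a0 b0 c0 d0] e1 e2 e3 e4]]]]] :=
    square_split (L0 0%N isT) (L0 2 isT) (L0 3 isT) (L0 4 isT) (rel _ (mem_head _ _)).
  (* The list is indexed by the rays; $a,b,c,d$ belong to the rays 1, 5, 4, 2, in this cyclic
     order. *)
  exists (nth 0 [:: L 5; a; d; L 1%N; c; b]); split.
    by case=> [|[|[|[|[|[|j]]]]]] // _ /=; rewrite ?L0.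
  by case=> [|[|[|[|[|[|i]]]]]] // _; rewrite /= ?big_cons big_nil /=; lra.
have r1 : ((5, 3), (1, 8))%N \in relations 5 by [].
have r2 : ((0, 7), (4, 6))%N \in relations 5 by [].
have [a [b [c [d [[a0 b0 c0 d0] e1 e2 e3 e4]]]]] :=
  square_split (L0 5 isT) (L0 1%N isT) (L0 3 isT) (L0 8 isT) (rel _ r1).
have [a' [b' [c' [d' [[a0' b0' c0' d0'] e1' e2' e3' e4']]]]] :=
  square_split (L0 0%N isT) (L0 4 isT) (L0 7 isT) (L0 6 isT) (rel _ r2).
exists (nth 0 [:: L 9; a; d; a'; d'; c; c'; b; L 2; b']); split.
  by case=> [|[|[|[|[|[|[|[|[|[|j]]]]]]]]]] // _ /=; rewrite ?L0.
by case=> [|[|[|[|[|[|[|[|[|[|i]]]]]]]]]] // _; rewrite /= ?big_cons big_nil /=; lra.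
Qed.

(** * The closed cone *)

Section ClosedCone.
Variables (R : realType) (N : nat) (A : set 'rV[R]_N).
Local Notation K := (closure (conic_hull A)).

Lemma closure_conic_hull0 : K 0.
Proof.
apply: subset_closure; exists 0%N, (fun=> 0), (fun=> 0); split=> // [[]//|].
by rewrite big_ord0.
Qed.

Lemma closure_conic_hullD x y : K x -> K y -> K (x + y).
Proof.
move=> Kx Ky B /nbhs_ballP[e /= e0 eB]; have e2 : 0 < e / 2 by rewrite divr_gt0.
have [a [[k [c [u [c0 uA aE]]]] xa]] := Kx _ (nbhsx_ballx x _ e2).
have [b [[k' [c' [u' [c0' uA' bE]]]] yb]] := Ky _ (nbhsx_ballx y _ e2).
exists (a + b); split.
  exists (k + k')%N, (fun i => match fintype.split i with inl i => c i | inr i => c' i end),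
    (fun i => match fintype.split i with inl i => u i | inr i => u' i end).
  split=> [i|i|]; try by case: (fintype.split i).
  rewrite big_split_ord aE bE /=; congr (_ + _); apply: eq_bigr => i _.
    by rewrite (unsplitK (inl i)).
  by rewrite (unsplitK (inr i)).
apply: eB; split=> // i j; rewrite !mxE /ball /= opprD addrACA.
case: xa yb => _ /(_ i j) xa [_ /(_ i j) yb].
by rewrite (splitr e) (le_lt_trans (ler_normD _ _)) // ltrD.
Qed.

Lemma closure_conic_hullZ a x : 0 <= a -> K x -> K (a *: x).
Proof.
rewrite le_eqVlt => /predU1P[<- _|a0 Kx B /nbhs_ballP[e /= e0 eB]].
  by rewrite scale0r; apply: closure_conic_hull0.
have ea : 0 < e / a by rewrite divr_gt0.
have [b [[k [c [u [c0 uA bE]]]] xb]] := Kx _ (nbhsx_ballx x _ ea).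
exists (a *: b); split.
  exists k, (fun i => a * c i), u; split=> // [i|]; first by rewrite mulr_ge0 // ltW.
  by rewrite bE scaler_sumr; apply: eq_bigr => i _; rewrite scalerA.
apply: eB; split=> // i j; case: xb => _ /(_ i j).
by rewrite !mxE /ball /= -mulrBr normrM gtr0_norm // ltr_pdivlMr // mulrC.
Qed.

Lemma conic_hull_ge0 (l : {scalar 'rV[R]_N}) x :
  (forall y, A y -> 0 <= l y) -> conic_hull A x -> 0 <= l x.
Proof.
move=> lA [k [c [u [c0 uA ->]]]]; rewrite linear_sum sumr_ge0 // => i _.
by rewrite linearZ mulr_ge0 // lA.
Qed.

Lemma closure_conic_hull_ge0 (l : {scalar 'rV[R]_N}) x :
  (forall y, A y -> 0 <= l y) -> K x -> 0 <= l x.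
Proof. by move=> lA; apply: closure_ge0 => y; apply: conic_hull_ge0. Qed.

Lemma closure_conic_hull_eq0 (l : {scalar 'rV[R]_N}) x :
  (forall y, A y -> l y = 0) -> K x -> l x = 0.
Proof.
move=> lA Kx; apply/eqP; rewrite eq_le (closure_conic_hull_ge0 _ Kx) => [|y /lA -> //].
rewrite andbT -oppr_ge0; apply: (closure_conic_hull_ge0 (l := \- l) _ Kx) => y /lA /= ->.
by rewrite oppr0.
Qed.

End ClosedCone.

(** * The cone in rank at most six *)

Section LowRank.
Variables (R : realType) (n : nat).
Hypothesis n5 : (n <= 5)%N.
Local Notation E := (flag_space R n).
Local Notation C := (@eulerian_cone R n).
Local Notation m := 'C(n, n./2).
Local Notation L b := (@flagL R n (set_of_bits n b)).

Let ray_system j := set_of_pairs n (nth_ray n j).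
Let ray_vector (j : 'I_m) : E := doubled_limit_flag_vector R (ray_system j).
Let form i : {scalar E} := @facet_form R n (facet_m n (nth_facet n i)) (facet_v n (nth_facet n i)).
Let form_ord (i : 'I_m) := form i.

Let size_rays : size (rays n) = m.
Proof. by have /andP[/and4P[/eqP]] := data_okP n5. Qed.

Let size_facets : size (facets n) = m.
Proof. by have /andP[/and4P[_ /eqP]] := data_okP n5. Qed.

Let ray_even j : (j < m)%N -> even_pairs n (nth_ray n j).
Proof.
rewrite -size_rays => jm; have /andP[/and4P[_ _ /allP H _] _] := data_okP n5.
exact/H/mem_nth.
Qed.

Let ray_in_cone (j : 'I_m) : C (ray_vector j).
Proof.
apply: doubled_limit_in_cone; have ev := ray_even (ltn_ord j).
have /andP[/and4P[_ _ _ /allP H] _] := data_okP n5.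
have : balanced n (nth_ray n j) by apply/H/mem_nth; rewrite size_rays.
have pJ := perm_pairs_of ev; rewrite /balanced (perm_size pJ).
rewrite /cover_count; under eq_all => e do (under eq_all => i do (under eq_all => k do
  (under eq_count => l do rewrite -(seq.permP pJ); under [X in _ == X]eq_count => l do rewrite -(seq.permP pJ)))).
done.
Qed.

Lemma size_bits_of_list s : size (bits_of_list n s) = n.
Proof. by rewrite size_map size_iota. Qed.

Let facet_okP i : (i < m)%N -> facet_ok n (nth_facet n i).
Proof.
rewrite -size_facets => im; have /andP[_ /and5P[H _ _ _ _]] := data_okP n5.
by apply: (allP H); exact: mem_nth.
Qed.

Let formE i j : (i < m)%N ->
  form i (ray_vector j) = ((nat_of_ord j) \in facet_off (nth_facet n i))%:R.
Proof.
move=> im; have /and5P[mv _ _ _ /andP[_ /allP val]] := facet_okP im.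
rewrite /form /= (facet_form_doubled_limit _ (perm_pairs_of (ray_even (ltn_ord j)))) ?size_bits_of_list //.
have jm : nat_of_ord j \in iota 0 (size (rays n)) by rewrite mem_iota size_rays /=.
have /eqP -> := val _ jm; by case: (_ \in _).
Qed.

Let sparse (x : E) := forall b, b \in all_bits n -> ~~ even_runs false b -> L b x = 0.

Let size_all_bits b : b \in all_bits n -> size b = n.
Proof.
by move/size_mem_bits_between; rewrite !size_nseq implb_nseq_true ?size_nseq //; apply.
Qed.

Let cone_sparse x : C x -> sparse x.
Proof.
move=> Cx b bn ev; apply: (closure_conic_hull_eq0 (l := L b) _ Cx).
move=> _ [d [P [rho [rhoP top eP ->]]]]; apply: flagL_eulerian0 => //; exact: size_all_bits.
Qed.

Let cone_form_ge0 i x : (i < m)%N -> C x -> 0 <= form i x.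
Proof.
move=> im Cx; have /and5P[mv /eqP cE /eqP sg _ _] := facet_okP im.
apply: (closure_conic_hull_ge0 (l := form i) _ Cx) => _ [d [P [rho [rhoP top eP ->]]]].
have sM := size_bits_of_list (facet_M (nth_facet n i)).
have sV := size_bits_of_list (facet_V (nth_facet n i)).
exact: (facet_form_eulerian_ge0 R rhoP top eP sM sV mv cE sg).
Qed.

Let hull_in_cone x : conic_hull (range ray_vector) x -> C x.
Proof.
move=> /conic_hull_range[c c0 ->]; apply: (big_ind C).
- exact: closure_conic_hull0.
- by move=> y z; apply: closure_conic_hullD.
- by move=> j _; apply: closure_conic_hullZ => //; exact: ray_in_cone.
Qed.

Let form_sumE i x : (i < m)%N ->
  form i x = \sum_(b <- all_bits n) (form_coef n (nth_facet n i) b)%:~R * L b x.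
Proof.
move=> im; have /and5P[mv _ _ _ _] := facet_okP im.
rewrite /form /= /facet_form sum_set_bits ?size_bits_of_list // card_set_of_bits ?size_bits_of_list //.
rewrite -signr_odd big_distrr /= /form_coef.
set s := bits_between _ _; rewrite [RHS](bigID (mem s)) /= [X in _ + X]big1 ?addr0; last first.
  by move=> b /negbTE ->; rewrite mul0r.
rewrite -[RHS]big_filter; have pE : perm_eq s [seq b <- all_bits n | b \in s].
  apply: uniq_perm; rewrite ?filter_uniq ?uniq_bits_between // => b.
  rewrite mem_filter; apply/esym/andb_idr => bs; rewrite /all_bits mem_bits_between ?size_nseq //; last first.
    by rewrite implb_nseq_true ?size_nseq.
  have sb : size b = n by have := size_mem_bits_between _ mv bs; rewrite !size_bits_of_list; apply.
  by rewrite sb eqxx implb_nseq_false // implb_nseq_true.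
rewrite -(perm_big _ pE) /= big_seq [RHS]big_seq; apply: eq_bigr => b ->.
by case: odd.
Qed.

Let form_relation x r : sparse x -> r \in relations n ->
  form r.1.1 x + form r.1.2 x = form r.2.1 x + form r.2.2 x.
Proof.
move=> sx rn; have /andP[_ /and5P[_ _ _ _ /allP/(_ _ rn)]] := data_okP n5.
rewrite /relation_ok size_facets => /andP[/and4P[h1 h2 h3 h4] /allP H].
rewrite !form_sumE // -!big_split /=; apply: eq_big_seq => b bn.
have [ev|ev] := boolP (even_runs false b); last by rewrite (sx b) // !mulr0.
by rewrite -!mulrDl -!intrD; have := H b bn; rewrite ev => /eqP ->.
Qed.

Let learnP (x : E) known fs :
  (forall b, b \in known -> L b x = 0) ->
  (forall f, f \in fs -> all2 implb (facet_m n f) (facet_v n f)) ->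
  (forall f, f \in fs -> facet_form (facet_m n f) (facet_v n f) x = 0) ->
  forall b, b \in foldl (learn n) known fs -> L b x = 0.
Proof.
elim: fs known => //= f fs IH known Hk imp Hf; apply: IH; last 2 first.
- by move=> g gf; apply: imp; rewrite inE gf orbT.
- by move=> g gf; apply: Hf; rewrite inE gf orbT.
rewrite /learn; case sE: [seq _ <- _ | _] => [|b [|? ?]] // t; rewrite inE => /predU1P[->|]; last exact: Hk.
have := Hf f (mem_head _ _); rewrite /facet_form sum_set_bits ?size_bits_of_list ?imp ?mem_head //.
move=> /eqP; rewrite mulf_eq0 signr_eq0 /= (bigID (mem known)) /= big1 => [|u]; last exact: Hk.
by rewrite add0r -big_filter sE big_seq1 => /eqP.
Qed.

Let sparseB a (x y : E) : sparse x -> sparse y -> sparse (x + a *: y).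
Proof. by move=> sx sy b bn ev; rewrite linearD linearZ /= sx // sy // mulr0 addr0. Qed.

Let form_inj (x : E) : sparse x -> (forall i, (i < m)%N -> form i x = 0) -> x = 0.
Proof.
move=> sx fx; apply: flagL_inj => b bn; rewrite linear0.
have /andP[_ /and5P[_ _ _ /allP/(_ _ bn) H _]] := data_okP n5.
have nthE f : f \in facets n -> exists2 i, (i < m)%N & f = nth_facet n i.
  by move=> fn; exists (index f (facets n)); rewrite ?nth_index // -size_facets index_mem.
apply: learnP H => [u|f /nthE[i im ->]|f /nthE[i im ->]].
- by rewrite mem_filter => /andP[ev un]; apply: sx.
- by have /and5P[] := facet_okP im.
- exact: fx.
Qed.

(** [facet_solvable] produces a point of the hull with the same form values as $x$. The difference
    has vanishing uneven coordinates and is killed by all forms, hence is zero by [form_inj]. *)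
Let polyhedron_hull x : sparse x -> (forall i, (i < m)%N -> 0 <= form i x) ->
  conic_hull (range ray_vector) x.
Proof.
move=> sx fx; have [||c [c0 cE]] := @facet_solvable R n (fun i => form i x) n5.
- by rewrite size_facets.
- by move=> r; apply: form_relation.
rewrite size_facets in c0 cE.
apply/conic_hull_range; exists (fun j : 'I_m => c j) => [j|]; first exact: c0.
set y := \sum_j _; apply/eqP; rewrite -subr_eq0; apply/eqP/form_inj.
  rewrite -scaleN1r; apply: sparseB => //; apply: cone_sparse; apply: hull_in_cone.
  by apply/conic_hull_range; exists (fun j : 'I_m => c j) => // j; exact: c0.
move=> i im; rewrite linearB /= -cE // /y linear_sum.
have /and5P[_ _ _ _ /andP[/andP[uo /allP lo] _]] := facet_okP im.
under [X in _ - X]eq_bigr do rewrite linearZ /= formE //.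
rewrite (bigID (fun j : 'I_m => nat_of_ord j \in facet_off (nth_facet n i))) /=.
rewrite [X in _ - (_ + X)]big1 ?addr0 => [|j /negbTE ->]; last by rewrite mulr0.
under [X in _ - X]eq_bigr => j -> do rewrite mulr1.
rewrite -(big_mkord (fun j => j \in facet_off (nth_facet n i)) c) -[X in _ - X]big_filter.
apply/eqP; rewrite subr_eq0; apply/eqP; apply: perm_big; apply: uniq_perm => //.
  by rewrite filter_uniq // iota_uniq.
move=> j; rewrite mem_filter mem_index_iota /=; apply/esym/andb_idr => jo.
by rewrite -size_rays lo.
Qed.

Let cone_gen : C = conic_hull (range ray_vector).
Proof.
apply/seteqP; split=> x; last exact: hull_in_cone.
by move=> Cx; apply: polyhedron_hull => [|i im]; [exact: cone_sparse | exact: cone_form_ge0].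
Qed.

Let cone_ineq x : C x <-> sparse x /\ forall i : 'I_m, 0 <= form_ord i x.
Proof.
split=> [Cx|[sx fx]]; first by split=> [|i]; [exact: cone_sparse | exact: cone_form_ge0].
by rewrite cone_gen; apply: polyhedron_hull => // i im; apply: (fx (Ordinal im)).
Qed.

Let separatedP : incidence_separates n.
Proof. by have /andP[_ /and5P[]] := data_okP n5. Qed.

Let form_pos (j : 'I_m) : exists i : 'I_m, 0 < form_ord i (ray_vector j).
Proof.
have /and3P[/allP/(_ (nat_of_ord j)) + _ _] := separatedP; rewrite mem_iota size_rays => /(_ (ltn_ord j)).
move=> /hasP[i]; rewrite mem_iota => im ji; exists (Ordinal im).
by rewrite /form_ord formE // ji ltr01.
Qed.

Let ray_separated (j k : 'I_m) : j != k ->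
  exists i : 'I_m, form_ord i (ray_vector j) = 0 /\ 0 < form_ord i (ray_vector k).
Proof.
move=> jk; have /and3P[_ /allP/(_ (nat_of_ord j)) + _] := separatedP.
rewrite mem_iota size_rays => /(_ (ltn_ord j))/allP/(_ (nat_of_ord k)).
rewrite mem_iota => /(_ (ltn_ord k))/implyP/(_ jk)/hasP[i]; rewrite mem_iota => im /andP[ji ki].
by exists (Ordinal im); rewrite /form_ord !formE // (negbTE ji) ki ltr01.
Qed.

Let facet_separated (i k : 'I_m) : i != k ->
  exists j : 'I_m, form_ord i (ray_vector j) = 0 /\ 0 < form_ord k (ray_vector j).
Proof.
move=> ik; have /and3P[_ _ /allP/(_ (nat_of_ord i))] := separatedP.
rewrite mem_iota size_rays => /(_ (ltn_ord i))/allP/(_ (nat_of_ord k)).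
rewrite mem_iota => /(_ (ltn_ord k))/implyP/(_ ik)/hasP[j]; rewrite mem_iota => jm /andP[ji ki].
by exists (Ordinal jm); rewrite /form_ord !formE // (negbTE ji) ki ltr01.
Qed.

(** If two rays $p$ and $q$ lie off the facet, the relation $v_p+v_r=v_q+v_s$ with $r$ and $s$ on it
    recovers $v_q$ from $v_p$ and the tight rays. *)
Let facet_spanned (i : 'I_m) : exists2 j : 'I_m, 0 < form_ord i (ray_vector j) &
  forall k, ray_vector k \in (<<tight ray_vector form_ord i>> + <[ray_vector j]>)%VS.
Proof.
have /and5P[_ _ _ _ /andP[/andP[_ /allP lo] _]] := facet_okP (ltn_ord i).
have tightP (k : 'I_m) (W : {vspace E}) : nat_of_ord k \notin facet_off (nth_facet n i) ->
    ray_vector k \in (<<tight ray_vector form_ord i>> + W)%VS.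
  move=> ko; apply: (subvP (addvSl _ _)); apply/memv_span/map_f.
  by rewrite mem_filter mem_enum /form_ord formE // (negbTE ko) eqxx.
have /andP[_ /and5P[_ /allP H _ _ _]] := data_okP n5.
have {H} := H _ (mem_nth empty_facet (_ : (i < size (facets n))%N)); rewrite size_facets => /(_ (ltn_ord i)).
rewrite /span_ok; case offE: (facet_off _) => [|p [|q [|? ?]]] //.
  move=> _; have pm : (p < m)%N by rewrite -size_rays lo // offE mem_head.
  exists (Ordinal pm); first by rewrite /form_ord formE // offE mem_head ltr01.
  move=> k; have [kp|kp] := eqVneq (nat_of_ord k) p; last by apply: tightP; rewrite offE inE.
  have -> : k = Ordinal pm by apply: val_inj.
  exact: (subvP (addvSr _ _)) (memv_line _).
case: (facet_rel _) => r s; rewrite size_rays => /and5P[rm sm ro so /allP rel].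
have pm : (p < m)%N by rewrite -size_rays lo // offE mem_head.
have qm : (q < m)%N by rewrite -size_rays lo // offE !inE eqxx orbT.
exists (Ordinal pm); first by rewrite /form_ord formE // offE mem_head ltr01.
move=> k; have [kp|kp] := eqVneq (nat_of_ord k) p.
  have -> : k = Ordinal pm by apply: val_inj.
  exact: (subvP (addvSr _ _)) (memv_line _).
have [kq|kq] := eqVneq (nat_of_ord k) q; last by apply: tightP; rewrite offE !inE negb_or kp.
(* The relation between rays is checked on the integers $L_b$, which determine a flag vector. *)
have -> : ray_vector k = ray_vector (Ordinal pm) + (ray_vector (Ordinal rm) - ray_vector (Ordinal sm)).
  apply: flagL_inj => b bn; rewrite linearD linearB /=.
  have val (j : 'I_m) : L b (ray_vector j) = (ray_value (nth_ray n j) b)%:~R.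
    by apply: flagL_doubled_limit (size_all_bits bn); apply: perm_pairs_of; apply: ray_even.
  rewrite !val /= kq addrA; have /eqP := rel _ bn.
  by move=> /(congr1 (fun z : int => z%:~R : R)); rewrite !intrD => ->; rewrite addrK.
rewrite memvD // ?memvB //; last 2 first.
- by apply: tightP; rewrite offE in so *.
- by apply: tightP; rewrite offE in ro *.
exact: (subvP (addvSr _ _)) (memv_line _).
Qed.

Lemma eulerian_cone_low_rank :
  [/\ finitely_generated C,
      ([set r | extreme_ray C r] #= `I_m)%card /\
      (forall r, extreme_ray C r ->
        exists2 II : {set 'I_n * 'I_n}, even_interval_system II &
          r = ray (doubled_limit_flag_vector R II)) &
      ([set F | facet C F] #= `I_m)%card /\
      (forall F, facet C F -> exists M V : {set 'I_n}, admissible M V /\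
          determines_facet C
            (fun v => (-1) ^+ (#|M|./2) *
               \sum_(Q : {set 'I_n} | (M \subset Q) && (Q \subset V)) flagL Q v)
            F)].
Proof.
have rayP := polyhedral_extreme_rayP cone_gen cone_ineq form_pos ray_separated.
have facetP := polyhedral_facetP cone_gen cone_ineq sparseB form_pos facet_spanned.
split.
- exists [seq ray_vector j | j <- enum 'I_m]; rewrite [LHS]cone_gen; congr conic_hull.
  apply/seteqP; split=> x /=; first by case=> j _ <-; rewrite map_f // mem_enum.
  by move=> /mapP[j _ ->]; exists j.
- split; last first.
    move=> r /rayP[j ->]; exists (ray_system j) => //.
    exact: even_interval_system_of_pairs (ray_even (ltn_ord j)).
  have -> : [set r | extreme_ray C r] = range (fun j => ray (ray_vector j)).
    apply/seteqP; split=> r /=; first by move=> /rayP[j ->]; exists j.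
    by case=> j _ <-; apply/rayP; exists j.
  apply: card_range_ord; exact: polyhedral_ray_inj ray_separated.
split.
  have -> : [set F | facet C F] = range (face form_ord C).
    apply/seteqP; split=> F /=; first by move=> /facetP[i ->]; exists i.
    by case=> i _ <-; apply/facetP; exists i.
  apply: card_range_ord; exact: polyhedral_face_inj cone_gen facet_separated.
move=> F /facetP[i ->].
exists (set_of_bits n (facet_m n (nth_facet n i))), (set_of_bits n (facet_v n (nth_facet n i))).
have /and5P[mv _ _ adm _] := facet_okP (ltn_ord i); split.
  by apply: admissible_bool adm; rewrite ?size_bits_of_list.
exact: (polyhedral_determines_facet cone_gen cone_ineq form_pos facet_spanned).
Qed.

End LowRank.

Local Open Scope card_scope.
Local Open Scope ring_scope.
Unset Implicit Arguments.

Theorem theorem4p7 (R : realType) (n : nat) (hn : (n + 1 <= 6)%N) :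
  let C := @eulerian_cone R n in
  [/\ finitely_generated C,
      [set r | extreme_ray C r] #= `I_('C(n, n./2)) /\
      (forall r, extreme_ray C r ->
        exists2 II : {set 'I_n * 'I_n}, even_interval_system II &
          r = ray (doubled_limit_flag_vector R II)) &
      [set F | facet C F] #= `I_('C(n, n./2)) /\
      (forall F, facet C F ->
        determines_facet C (fun v => \sum_(Q : {set 'I_n}) flagL Q v) F \/
        exists M V : {set 'I_n}, admissible M V /\
          determines_facet C
            (fun v => (-1) ^+ (#|M|./2) *
               \sum_(Q : {set 'I_n} | (M \subset Q) && (Q \subset V)) flagL Q v)
            F)].
Proof.
have n5 : (n <= 5)%N by rewrite -ltnS -addn1.
have [fg rays_card [facets_card facetsP]] := eulerian_cone_low_rank R n5.
(* In the table the sum over all $Q$ appears as the admissible pair $(\emptyset,[1,n])$, or for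
   $n=1$ as $(\emptyset,\emptyset)$, since $L_{\{1\}}$ vanishes on the cone there. Every facet is
   thus reached by the second alternative. *)
by split=> //; split=> // F /facetsP; right.
Qed.
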